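(* Let $\mathbf{f}:\mathbb{R}^N\to\mathbb{R}^N$ be a $C^1$-mapping with a globally bounded gradient. Then, for arbitrary $\mathbf{x}_0\in\mathbb{R}^N$ and $T>0$, the problem $$\mathbf{x}'(t)=\mathbf{f}(\mathbf{x}(t)),\qquad \mathbf{x}(0)=\mathbf{x}_0,$$ admits a unique $C^1$-solution $\overline{\mathbf{x}}:[0,T)\to\mathbb{R}^N$, and there is a constant $C>0$ such that $$\int_0^T|\mathbf{x}'(s)-\overline{\mathbf{x}}'(s)|^2\,ds\le C\int_0^T|\mathbf{x}'(s)-\mathbf{f}(\mathbf{x}_0+\mathbf{x}(s))|^2\,ds$$ for every $\mathbf{x}\in\mathbb{H}$.
   Context: $\mathbb{H}=\{\mathbf{z}:[0,T]\to\mathbb{R}^N:\ \mathbf{z}\in H^1(0,T;\mathbb{R}^N),\ \mathbf{z}(0)=\mathbf{0}\}$, a subspace of the standard Sobolev space $H^1(0,T;\mathbb{R}^N)$, with norm $\|\mathbf{z}\|_{\mathbb{H}}^2=\int_0^T|\mathbf{z}'(s)|^2\,ds$. *)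

(* Defs.v *)
From HB Require Import structures.
From mathcomp Require Import all_boot all_order all_algebra.
From mathcomp Require Import all_classical all_reals all_analysis.
Set Implicit Arguments.
Unset Strict Implicit.
Unset Printing Implicit Defensive.
Import Order.TTheory GRing.Theory Num.Theory.
Import numFieldNormedType.Exports.
Local Open Scope classical_set_scope.
Local Open Scope ring_scope.

(* Square of the Euclidean norm; the library norm `|v| on 'rV is the sup norm. *)
Definition enorm2 (R : realType) (N : nat) (v : 'rV[R]_N) : R :=
  \sum_(i < N) v 0 i ^+ 2.

Definition C1_map (R : realType) (N : nat) (f : 'rV[R]_N -> 'rV[R]_N) : Prop :=
  (forall p, differentiable f p) /\ continuous (fun p => 'J f p).

(* Boundedness does not depend on the choice of the norm on matrices. *)
Definition bounded_gradient (R : realType) (N : nat)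
    (f : 'rV[R]_N -> 'rV[R]_N) : Prop :=
  exists M : R, forall p, `|'J f p| <= M.

(* Derivatives relative to a set D, so one-sided at an endpoint lying in D.
   [x] is a total function, but only its values on D matter. *)
Definition diff_quot (R : realType) (N : nat) (x : R -> 'rV[R]_N) (t : R) :
  R -> 'rV[R]_N := fun s => (s - t)^-1 *: (x s - x t).

Definition derivable_within (R : realType) (N : nat) (D : set R)
    (x : R -> 'rV[R]_N) (t : R) : Prop :=
  cvg (diff_quot x t @ within D t^').

Definition derive_within (R : realType) (N : nat) (D : set R)
    (x : R -> 'rV[R]_N) (t : R) : 'rV[R]_N :=
  lim (diff_quot x t @ within D t^').

Definition C1_on (R : realType) (N : nat) (D : set R)
    (x : R -> 'rV[R]_N) : Prop :=
  (forall t, D t -> derivable_within D x t) /\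
  {within D, continuous (derive_within D x)}.

Definition C1_solution (R : realType) (N : nat) (f : 'rV[R]_N -> 'rV[R]_N)
    (x0 : 'rV[R]_N) (T : R) (x : R -> 'rV[R]_N) : Prop :=
  [/\ C1_on `[0, T[ x,
      forall t, t \in `[0, T[ -> derive_within `[0, T[ x t = f (x t)
    & x 0 = x0].

(* C_c^oo(0, T), each test function being extended by 0 to the whole line. *)
Definition test_function (R : realType) (T : R) (phi : R -> R) : Prop :=
  [/\ forall n t, derivable (derive1n n phi) t 1,
      compact (closure [set t | phi t != 0])
    & closure [set t | phi t != 0] `<=` `]0, T[].

Definition L2 (R : realType) (N : nat) (T : R) (z : R -> 'rV[R]_N) : Prop :=
  (forall i, measurable_fun `]0, T[ (fun t => z t 0 i)) /\
  (\int[lebesgue_measure]_(t in `]0%R, T[) (enorm2 (z t))%:E < +oo)%E.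

(* [z] is in H^1(0, T; R^N), with (a representative of) its weak derivative
   [dz]. *)
Definition H1_with_derivative (R : realType) (N : nat) (T : R)
    (z dz : R -> 'rV[R]_N) : Prop :=
  [/\ L2 T z, L2 T dz
    & forall phi, test_function T phi -> forall i,
        \int[lebesgue_measure]_(t in `]0, T[) (z t 0 i * derive1 phi t) =
        - \int[lebesgue_measure]_(t in `]0, T[) (dz t 0 i * phi t)].

Definition H1 (R : realType) (N : nat) (T : R) (z : R -> 'rV[R]_N) : Prop :=
  exists dz, H1_with_derivative T z dz.

(* The space of the z in H^1(0, T; R^N) with z(0) = 0.  As usual, the value
   z(0) is that of the representative which is continuous on [0, T]. *)
Definition HH (R : realType) (N : nat) (T : R) (z : R -> 'rV[R]_N) : Prop :=
  [/\ H1 T z, {within `[0, T], continuous z} & z 0 = 0].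

(* Main.v *)
Require Import Defs.
From mathcomp Require Import all_boot all_order all_algebra.
From mathcomp Require Import all_classical all_reals all_analysis.
From mathcomp Require Import measurable_realfun ring lra.
Set Implicit Arguments.
Unset Strict Implicit.
Unset Printing Implicit Defensive.
Import Order.TTheory GRing.Theory Num.Theory.
Import numFieldNormedType.Exports.
Local Open Scope classical_set_scope.
Local Open Scope ring_scope.

(** The bounded gradient makes [f] Lipschitz on the whole space, with a
constant [L] for the sup norm, and everything follows from that bound.

Existence. The Picard operator [y |-> x0 + int_0^t f (y s) ds] halves distances
measured with the weight [exp (- 2 L t)] on the half-line [0, +oo[, so that its
iterates converge on the whole half-line at once and no local solution has to be
continued ([picard_fixed_point], [C1_solution_exists]).  Uniqueness is Gronwall's
inequality for the distance of two solutions ([C1_solution_unique]).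

The estimate. Let [w = x0 + x - xbar] and let [r = dx - f (x0 + x)] be the
residual, with [J] the integral of its square.  Then [w' = r + f (x0 + x) - f xbar],
so [|w'| <= |r| + L |w|], and [w 0 = 0].  Integrating, applying Gronwall and
bounding the integral of [|r|] by Cauchy-Schwarz give
[|w| <= exp (L T) sqrt (T J)] everywhere ([deviation_le]).  Put back into the
formula for [w'], this bounds [|w'|^2] by [2 |r|^2] plus a constant multiple of
[J], and it remains to integrate ([deviation_derivative_le]).

The step that is not elementary calculus is the first integration: [dx] is known
only as a weak derivative, that is, through integrals against smooth functions
with compact support in ]0, T[.  Testing with smooth plateaus that converge to the
indicator function of ]a, b] gives [x b - x a = int_a^b dx]
([weak_derivative_increment]).  The plateaus are built from
[exp (- 1 / (t (1 - t)))], which, multiplied by polynomials in [t] and powers of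
[1 / (t (1 - t))], forms a family closed under derivation
([exp_bump_derive]). *)

(** * Mean values and the Lipschitz bound *)

(** Monotonicity of [H - G] and of [H + G].  This single comparison replaces all
estimates of the form [|int G'| <= int |G'|] for functions with a derivative. *)
Lemma mean_value_le (R : realType) (G H dG dH : R -> R) (a b : R) :
  a <= b ->
  {within `[a, b], continuous G} -> {within `[a, b], continuous H} ->
  (forall t, t \in `]a, b[ -> is_derive t 1 G (dG t)) ->
  (forall t, t \in `]a, b[ -> is_derive t 1 H (dH t)) ->
  (forall t, t \in `]a, b[ -> `|dG t| <= dH t) ->
  `|G b - G a| <= H b - H a.
Proof.
rewrite le_eqVlt => /predU1P[-> *|ab cG cH dGP dHP le_d].
  by rewrite !subrr normr0.
have [c cab] : exists2 c, c \in `]a, b[ &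
    (H b - G b) - (H a - G a) = (dH c - dG c) * (b - a).
  apply: (@MVT R (H - G) (fun t => dH t - dG t) a b ab) => [t tab|].
    by apply: is_deriveB; [exact: dHP|exact: dGP].
  exact: within_continuousB.
have [d dab] : exists2 d, d \in `]a, b[ &
    (H b + G b) - (H a + G a) = (dH d + dG d) * (b - a).
  apply: (@MVT R (H + G) (fun t => dH t + dG t) a b ab) => [t tab|].
    by apply: is_deriveD; [exact: dHP|exact: dGP].
  exact: within_continuousD.
move=> eqd eqc.
have /ler_normlP[_ h1] := le_d _ cab; have /ler_normlP[h2 _] := le_d _ dab.
have ba : 0 <= b - a by rewrite subr_ge0 ltW.
have : 0 <= (dH c - dG c) * (b - a) by apply: mulr_ge0 => //; lra.
have : 0 <= (dH d + dG d) * (b - a) by apply: mulr_ge0 => //; lra.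
by rewrite -eqd -eqc ler_norml => h3 h4; apply/andP; split; lra.
Qed.

Lemma mx_norm_leP (R : realType) (N : nat) (v : 'rV[R]_N) (e : R) :
  0 <= e -> (forall i, `|v 0 i| <= e) <-> `|v| <= e.
Proof.
move=> e0; rewrite [in X in _ <-> X]/Num.Def.normr /= mx_normrE; split=> [ve|ve i].
  by apply/bigmax_leP; split=> // -[i j] _ /=; rewrite (ord1 i).
by move/bigmax_leP : ve => [_ /(_ (0, i) isT)].
Qed.

Lemma coord_le_norm (R : realType) (N : nat) (v : 'rV[R]_N) i : `|v 0 i| <= `|v|.
Proof. by move: i; apply/mx_norm_leP. Qed.

(** The mean value theorem holds for scalar functions only, hence it is applied to
each coordinate of [f] along the segment from [q] to [p].  A coordinate of
[v *m 'J f] is a sum of [N] products, which is where the factor [N] comes from. *)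
Lemma bounded_gradient_lipschitz (R : realType) (N : nat)
    (f : 'rV[R]_N -> 'rV[R]_N) :
  C1_map f -> bounded_gradient f ->
  exists2 L : R, 0 < L & forall p q, `|f p - f q| <= L * `|p - q|.
Proof.
move=> [df _] [M fM].
have M0 : 0 <= M by rewrite (le_trans _ (fM 0)).
exists (N%:R * M + 1) => [|p q]; first by rewrite ltr_wpDl // mulr_ge0.
set L := (X in X * _).
have L0 : 0 <= L by rewrite addr_ge0 // mulr_ge0.
apply/mx_norm_leP; first by rewrite mulr_ge0.
move=> i.
pose v : 'rV[R]_N := p - q; pose g (s : R) : R := f (q + s *: v) 0 i.
have dg (s : R) : is_derive s 1 g ((v *m 'J f (q + s *: v)) 0 i).
  have dfs := df (q + s *: v).
  have := @diff_derivable _ _ _ _ _ v dfs => /[dup] dvf /derivable_mxP /(_ 0 i) di.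
  have e : (fun h : R => h^-1 *: (g (h *: (1 : R) + s) - g s)) =
     fun h : R => h^-1 *: (f (h *: v + (q + s *: v)) 0 i - f (q + s *: v) 0 i).
    apply/funext => h; rewrite /g; congr (_ *: (f _ 0 i - _)).
    by rewrite scalerDl [h *: (1 : R)]mulr1 addrCA addrA.
  apply: DeriveDef; first by rewrite /derivable e.
  rewrite /derive e -deriveEjacobian // derive_mx // mxE //.
have := @mean_value_le R g (fun s => L * `|v| * s)
  (fun s => (v *m 'J f (q + s *: v)) 0 i)
  (fun=> L * `|v|) 0 1 ler01.
have qv : q + v = p by rewrite /v addrC subrK.
rewrite /g scale1r scale0r addr0 mulr1 mulr0 subr0 qv !mxE.
apply => //.
- move=> t; apply: continuous_subspaceT => s.
  by apply/differentiable_continuous/derivable1_diffP; case: (dg s).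
- by apply: continuous_subspaceT => s; apply: mulrl_continuous.
- by move=> t _; apply: is_derive_eq; exact: mulr1.
- move=> t _; rewrite mxE (le_trans (ler_norm_sum _ _ _)) //.
  apply: (@le_trans _ _ (\sum_(j < N) M * `|v|)).
    apply: ler_sum => j _; rewrite normrM mulrC ler_pM ?coord_le_norm //.
    apply: le_trans (fM (q + t *: v)).
    rewrite [leRHS]/Num.Def.normr /= mx_normrE; apply/bigmax_geP; right => /=.
    by exists (j, i).
  by rewrite sumr_const card_ord -mulr_natl mulrA /L mulrDl lerDl mul1r.
Qed.

(** * Primitives and the Gronwall inequality *)

(** The primitive vanishing at 0.  Integrating from -1 makes it differentiable at 0
on both sides. *)
Definition primitive (R : realType) (g : R -> R) (t : R) : R :=
  \int[lebesgue_measure]_(s in `[(-1)%R, t]) g s -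
  \int[lebesgue_measure]_(s in `[(-1)%R, 0]) g s.

Lemma primitive0 (R : realType) (g : R -> R) : primitive g 0 = 0.
Proof. exact: subrr. Qed.

Lemma continuous_integrable (R : realType) (g : R -> R) (a b : R) :
  continuous g -> lebesgue_measure.-integrable `[a, b] (EFin \o g).
Proof.
move=> cg; apply: continuous_compact_integrable; first exact: segment_compact.
exact: continuous_subspaceT.
Qed.

Lemma is_derive_primitive (R : realType) (g : R -> R) (t : R) :
  continuous g -> -1 < t -> is_derive t 1 (primitive g) (g t).
Proof.
move=> cg t1.
have := @continuous_FTC1_closed R g (-1) t (t + 1).
rewrite ltrDl ltr01 => /(_ isT (continuous_integrable _ _ cg) t1 (cg t)) [dF dFE].
rewrite -[g t]subr0; apply: is_deriveB.
by rewrite -dFE derive1E; exact/derivableP.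
Qed.

Lemma primitive_continuous (R : realType) (g : R -> R) (t : R) :
  continuous g -> -1 < t -> {for t, continuous (primitive g)}.
Proof.
move=> cg t1; apply/differentiable_continuous/derivable1_diffP.
by case: (is_derive_primitive cg t1).
Qed.

Lemma primitive_within (R : realType) (g : R -> R) (a b : R) :
  continuous g -> 0 <= a -> {within `[a, b], continuous (primitive g)}.
Proof.
move=> cg a0; apply: continuous_in_subspaceT => t.
rewrite inE/= in_itv/= => /andP[at_ _].
apply: primitive_continuous => //.
by rewrite (lt_le_trans _ at_) // (lt_le_trans _ a0) // ltrN10.
Qed.

Lemma primitiveB (R : realType) (g : R -> R) (a b : R) :
  continuous g -> 0 <= a -> a <= b ->
  primitive g b - primitive g a = \int[lebesgue_measure]_(s in `]a, b]) g s.
Proof.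
move=> cg a0 ab; rewrite /primitive.
rewrite -(@Rintegral_itvB _ g (BLeft (-1)) (BRight b) a) //.
- by rewrite opprB addrA subrK.
- exact: continuous_integrable.
- by rewrite bnd_simp (le_trans _ a0) // lerN10.
Qed.

Lemma primitive_ge0 (R : realType) (g : R -> R) (t : R) :
  continuous g -> (forall s, 0 <= g s) -> 0 <= t -> 0 <= primitive g t.
Proof.
move=> cg g0 t0; have := primitiveB cg (lexx 0) t0.
by rewrite primitive0 subr0 => ->; apply: Rintegral_ge0.
Qed.

(** The function [exp (- L s) (primitive n s + B / L)] is nonincreasing, because the
hypothesis says exactly that its derivative is nonpositive. *)
Lemma gronwall (R : realType) (n : R -> R) (B L T : R) :
  continuous n -> 0 < L ->
  (forall t : R, 0 <= t -> t < T -> n t <= B + L * primitive n t) ->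
  forall t : R, 0 <= t -> t < T -> n t <= B * expR (L * t).
Proof.
move=> cn L0 nle t t0 tT.
apply: (le_trans (nle t t0 tT)).
pose phi (s : R) : R := expR (- L * s) * (primitive n s + B / L).
have dphi (s : R) : 0 <= s ->
    is_derive s 1 phi (expR (- L * s) * (n s - L * primitive n s - B)).
  move=> s0; have dp : is_derive s 1 (primitive n) (n s).
    by apply: is_derive_primitive => //; rewrite (lt_le_trans _ s0) // ltrN10.
  apply: is_derive_eq; rewrite /GRing.scale/=; field.
  by rewrite gt_eqF.
have phi_le : phi t <= phi 0.
  move: t0; rewrite le_eqVlt => /predU1P[<- //|t0].
  have [||c ct] := @MVT R phi
      (fun s => expR (- L * s) * (n s - L * primitive n s - B)) 0 t t0.
  - by move=> s; rewrite in_itv/= => /andP[/ltW s0 _]; exact: dphi.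
  - apply: derivable_within_continuous => s; rewrite in_itv/= => /andP[s0 _].
    by case: (dphi s s0).
  move: ct; rewrite in_itv/= => /andP[c0 ct] e.
  rewrite -subr_le0 e subr0 mulr_le0_ge0 // ?(ltW t0) //.
  rewrite mulr_ge0_le0 ?expR_ge0 //.
  by have := nle c (ltW c0) (lt_trans ct tT); lra.
move: phi_le; rewrite /phi mulr0 expR0 mul1r primitive0 add0r mulNr expRN.
rewrite mulrC ler_pdivrMr ?expR_gt0 // => h.
have Ln0 : L != 0 by rewrite gt_eqF.
have -> : B + L * primitive n t = L * (primitive n t + B / L) by field.
have -> : B * expR (L * t) = L * (B / L * expR (L * t)) by field.
by rewrite ler_pM2l.
Qed.

(** * The Picard operator and its fixed point *)

Lemma continuous_rV (R : realType) (T : topologicalType) (N : nat) (y : T -> 'rV[R]_N) :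
  (forall i, continuous (fun t => y t 0 i)) -> continuous y.
Proof.
move=> cy t; apply/cvgrPdist_le => /= e e0; near=> s.
apply/mx_norm_leP; first exact: ltW.
near: s; apply: filter_forall => i.
have /cvgrPdist_le/(_ e e0) := cy i t.
by apply: filterS => s; rewrite !mxE.
Unshelve. all: by end_near. Qed.

Lemma continuous_coord (R : realType) (T : topologicalType) (N : nat) (y : T -> 'rV[R]_N) i :
  continuous y -> continuous (fun t => y t 0 i).
Proof.
move=> cy t; apply: (@continuous_comp _ _ _ y (fun M : 'rV[R]_N => M 0 i)).
  exact: cy.
exact: coord_continuous.
Qed.

Lemma lipschitz_continuous (R : realType) (N : nat) (f : 'rV[R]_N -> 'rV[R]_N) (L : R) :
  0 < L -> (forall p q, `|f p - f q| <= L * `|p - q|) -> continuous f.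
Proof.
move=> L0 fL p.
apply/(@cvgrPdist_le _ _ _ (nbhs p) (nbhs_filter p)) => /= e e0.
apply/(@nbhs_normP _ _ p); exists (e / L) => [|q /= pq]; first by rewrite /= divr_gt0.
by rewrite (le_trans (fL _ _)) // mulrC -ler_pdivlMr // ltW.
Qed.

Definition positive_part (R : realType) (t : R) : R := Num.max t 0.

Lemma continuous_positive_part (R : realType) : continuous (@positive_part R).
Proof.
move=> t; apply: (@continuous_max _ _ id (cst 0)) => //=; exact: cvg_cst.
Qed.

Lemma positive_part_ge0 (R : realType) (t : R) : 0 <= positive_part t.
Proof. by rewrite le_max lexx orbT. Qed.

Lemma positive_part_id (R : realType) (t : R) : 0 <= t -> positive_part t = t.
Proof. by move=> ?; apply/max_idPl. Qed.

(** Precomposing with [positive_part] freezes the function at [x0] for negative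
times; it is then continuous on the whole line while estimates are only needed for
nonnegative times. *)
Definition picard (R : realType) (N : nat) (f : 'rV[R]_N -> 'rV[R]_N) (x0 : 'rV[R]_N)
    (y : R -> 'rV[R]_N) (t : R) : 'rV[R]_N :=
  x0 + \row_i primitive (fun s => f (y s) 0 i) (positive_part t).

Lemma continuous_picard (R : realType) (N : nat) (f : 'rV[R]_N -> 'rV[R]_N) x0 y :
  continuous f -> continuous y -> continuous (picard f x0 y).
Proof.
move=> cf cy; apply: continuous_rV => i.
have -> : (fun t => picard f x0 y t 0 i) = cst (x0 0 i) +
    (primitive (fun s => f (y s) 0 i) \o @positive_part R).
  by apply/funext => t; rewrite /picard !mxE.
move=> t; apply: continuousD; first exact: cvg_cst.
apply: continuous_comp; first exact: continuous_positive_part.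
apply: primitive_continuous.
  apply: continuous_coord => s; apply: continuous_comp; [exact: cy|exact: cf].
by rewrite (lt_le_trans _ (positive_part_ge0 _)) // ltrN10.
Qed.

Section picard_contraction.
Context (R : realType) (N : nat) (f : 'rV[R]_N -> 'rV[R]_N) (L : R).
Hypothesis L0 : 0 < L.
Hypothesis fL : forall p q, `|f p - f q| <= L * `|p - q|.
Variable x0 : 'rV[R]_N.

Let w (t : R) := expR (2 * L * t).

Lemma is_derive_weight (c : R) (t : R) : is_derive t 1 (fun s => c * w s) (2 * L * c * w t).
Proof. by apply: is_derive_eq; rewrite /GRing.scale/= /w; ring. Qed.

Let cont_weight (c : R) : continuous (fun s => c * w s).
Proof.
by move=> s; apply/differentiable_continuous/derivable1_diffP; case: (is_derive_weight c s).
Qed.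

(** A bound [c w] on the distance makes the derivatives of the images differ by at
most [L c w], which is the derivative of [c / 2 w]. *)
Lemma picard_contraction (y z : R -> 'rV[R]_N) (c : R) :
  continuous y -> continuous z -> 0 <= c ->
  (forall t, 0 <= t -> `|y t - z t| <= c * w t) ->
  forall t, 0 <= t -> `|picard f x0 y t - picard f x0 z t| <= c / 2 * w t.
Proof.
move=> cy cz c0 yz t t0.
have cf := lipschitz_continuous L0 fL.
apply/mx_norm_leP; first by rewrite mulr_ge0 ?divr_ge0 ?expR_ge0.
move=> i; rewrite /picard !mxE positive_part_id //.
set g := primitive _; set h := primitive _.
have cfy : continuous (fun s => f (y s) 0 i).
  by apply: continuous_coord => s; apply: continuous_comp; [exact: cy|exact: cf].
have cfz : continuous (fun s => f (z s) 0 i).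
  by apply: continuous_coord => s; apply: continuous_comp; [exact: cz|exact: cf].
have := @mean_value_le R (g - h) (fun s => c / 2 * w s)
  (fun s => f (y s) 0 i - f (z s) 0 i) (fun s => 2 * L * (c / 2) * w s) 0 t t0.
have w0 : w 0 = 1 by rewrite /w mulr0 expR0.
rewrite !fctE [g 0]primitive0 [h 0]primitive0 !subr0 w0 => H.
apply: (@le_trans _ _ (c / 2 * w t - c / 2 * 1)); last first.
  by rewrite lerBlDr lerDl mulr1 divr_ge0.
rewrite opprD addrACA subrr add0r; apply: H.
- by apply: within_continuousB; apply: primitive_within.
- exact: continuous_subspaceT.
- move=> s; rewrite in_itv/= => /andP[s0 _].
  by apply: is_deriveB; apply: is_derive_primitive => //;
    rewrite (lt_trans _ s0) // ltrN10.
- by move=> s _; exact: is_derive_weight.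
- move=> s; rewrite in_itv/= => /andP[s0 _].
  have := coord_le_norm (f (y s) - f (z s)) i; rewrite !mxE => /le_trans; apply.
  rewrite (le_trans (fL _ _)) //.
  have -> : 2 * L * (c / 2) * w s = L * (c * w s) by field.
  by rewrite ler_pM2l // yz // ltW.
Qed.

Let Z (n : nat) : R -> 'rV[R]_N := iter n (picard f x0) (fun=> x0).

Let cZ n : continuous (Z n).
Proof.
elim: n => [|n IH]; first by move=> t; exact: cvg_cst.
by apply: continuous_picard => //; exact: lipschitz_continuous fL.
Qed.

(* With this choice [A w] has derivative [|f x0| w], which dominates the derivative
   [f x0] of the first iterate. *)
Let A : R := `|f x0| / (2 * L).

Let A0 : 0 <= A. Proof. by rewrite divr_ge0 // mulr_ge0 // ltW. Qed.

Let Z_step n (t : R) : 0 <= t -> `|Z n.+1 t - Z n t| <= A * 2^-1 ^+ n * w t.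
Proof.
elim: n t => [|n IH] t t0; last first.
  rewrite exprSr mulrA.
  apply: (@picard_contraction (Z n.+1) (Z n) (A * 2^-1 ^+ n)) => //.
  by rewrite mulr_ge0 // exprn_ge0.
rewrite expr0 mulr1.
apply/mx_norm_leP; first by rewrite mulr_ge0 ?expR_ge0.
move=> i; rewrite /= /picard !mxE positive_part_id // addrC addKr.
have := @mean_value_le R (primitive (fun=> f x0 0 i)) (fun s => A * w s)
  (fun=> f x0 0 i) (fun s => 2 * L * A * w s) 0 t t0.
rewrite primitive0 subr0 => H.
apply: (@le_trans _ _ (A * w t - A * w 0)); last first.
  by rewrite lerBlDr lerDl mulr_ge0 // expR_ge0.
apply: H.
- by apply: primitive_within => // s; exact: cvg_cst.
- exact: continuous_subspaceT.
- move=> s; rewrite in_itv/= => /andP[s0 _].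
  apply: (@is_derive_primitive _ (fun=> f x0 0 i)); first by move=> ?; exact: cvg_cst.
  by rewrite (lt_trans _ s0) // ltrN10.
- by move=> s _; exact: is_derive_weight.
- move=> s; rewrite in_itv/= => /andP[s0 _].
  rewrite (le_trans (coord_le_norm _ _)) //.
  rewrite /A mulrC mulrA [leRHS](_ : _ = `|f x0| * w s); last by field; rewrite gt_eqF.
  rewrite ler_peMr // /w -expR0 ler_expR; apply: mulr_ge0; last exact: ltW.
  by rewrite mulr_ge0 // ltW.
Qed.

(* The tail of the geometric series [sum 2^-n] is [2 * 2^-n]. *)
Let Z_dist n k (t : R) : 0 <= t -> `|Z (n + k)%N t - Z n t| <= 2 * A * 2^-1 ^+ n * w t.
Proof.
move=> t0; have w0 : 0 <= A * w t by rewrite mulr_ge0 ?expR_ge0.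
suff H : `|Z (n + k)%N t - Z n t| <= 2 * (2^-1 ^+ n - 2^-1 ^+ (n + k)) * (A * w t).
  apply: (le_trans H); rewrite [leRHS](_ : _ = 2 * 2^-1 ^+ n * (A * w t)); last by ring.
  rewrite ler_wpM2r // ler_pM2l // gerBl; exact: exprn_ge0.
elim: k => [|k IH]; first by rewrite addn0 !subrr normr0 mulr0 mul0r.
rewrite addnS -(subrKA (Z (n + k)%N t)) (le_trans (ler_normD _ _)) //.
apply: le_trans (lerD (Z_step _ t0) IH) _.
rewrite exprSr; set a := 2^-1 ^+ (n + k); set b := 2^-1 ^+ n.
by rewrite [leLHS](_ : _ = 2 * (b - a * 2^-1) * (A * w t)) //; field.
Qed.
Let geometric_le (C e : R) : 0 <= C -> 0 < e -> exists n, C * 2^-1 ^+ n <= e.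
Proof.
move=> C0 e0; have C1 : 0 < C + 1 by rewrite ltr_wpDl.
have [n _ /(_ n (leqnn n))] := @near_infty_natSinv_expn_lt R (PosNum (divr_gt0 e0 C1)).
rewrite /= div1r -exprVn ltr_pdivlMr // => h; exists n.
apply: le_trans (ltW h); rewrite mulrC ler_wpM2l ?exprn_ge0 //.
by rewrite lerDl.
Qed.

Let cvgZ (t : R) : 0 <= t -> cvg (Z n t @[n --> \oo]).
Proof.
move=> t0; apply/cauchy_cvgP/cauchy_exP => /= e e0.
have e2 : 0 < e / 2 by rewrite divr_gt0.
have Aw : 0 <= 2 * A * w t by rewrite mulr_ge0 ?expR_ge0 // mulr_ge0.
have [n ne] := geometric_le Aw e2.
exists (Z n t); exists n => // m /= nm.
rewrite -ball_normE /= -(subnKC nm) distrC (le_lt_trans (Z_dist n _ t0)) //.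
by rewrite mulrAC (le_lt_trans ne) // ltr_pdivrMr // ltr_pMr // ltr1n.
Qed.

(** The convergence is geometric with a factor that is bounded on bounded intervals.
Hence the limit is continuous, and the contraction inequality passes to the limit. *)
Lemma picard_fixed_point : exists X : R -> 'rV[R]_N,
  continuous X /\ forall t, 0 <= t -> X t = picard f x0 X t.
Proof.
pose X (t : R) : 'rV[R]_N := lim (Z n (positive_part t) @[n --> \oo]).
have XZ n (t : R) : 0 <= t -> `|X t - Z n t| <= 2 * A * 2^-1 ^+ n * w t.
  move=> t0; apply/ler_addgt0Pl => e e0.
  have ZX : Z n t @[n --> \oo] --> X t.
    by rewrite /X positive_part_id //; exact: cvgZ.
  move/cvgrPdist_le : ZX => /(_ e e0)[m _ /(_ (n + m)%N (leq_addl _ _)) /= Xm].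
  rewrite -(subrKA (Z (n + m)%N t)) (le_trans (ler_normD _ _)) // lerD //.
  exact: Z_dist.
have Xp t : X t = X (positive_part t).
  by rewrite /X (positive_part_id (positive_part_ge0 t)).
have Zp n t : Z n t = Z n (positive_part t).
  case: n => [//|n]; rewrite /= /picard.
  by rewrite (positive_part_id (positive_part_ge0 t)).
have cX : continuous X.
  move=> t; apply/cvgrPdist_le => /= e e0.
  pose W := w (positive_part t + 1).
  have e3 : 0 < e / 3 by rewrite divr_gt0.
  have AW : 0 <= 2 * A * W by rewrite mulr_ge0 ?expR_ge0 // mulr_ge0.
  have [n ne] := geometric_le AW e3.
  have XZW s : positive_part s <= positive_part t + 1 -> `|X s - Z n s| <= e / 3.
    move=> st; rewrite Xp Zp (le_trans (XZ _ _ (positive_part_ge0 s))) //.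
    apply: le_trans ne; rewrite [leRHS]mulrAC; apply: ler_wpM2l.
      by rewrite mulr_ge0 ?exprn_ge0 // mulr_ge0.
    by rewrite /W /w ler_expR ler_pM2l // mulr_gt0.
  near=> s.
  have st : positive_part s <= positive_part t + 1.
    have : `|positive_part t - positive_part s| <= 1.
      near: s; have /cvgrPdist_le := @continuous_positive_part R t; exact.
    by rewrite ler_norml; lra.
  have h1 := XZW s st; have h2 := XZW t (ltW (ltr_pwDr ltr01 (lexx _))).
  have h3 : `|Z n t - Z n s| <= e / 3.
    by near: s; have /cvgrPdist_le := @cZ n t; apply.
  rewrite [leRHS](_ : _ = e / 3 + (e / 3 + e / 3)); last by field.
  have -> : X t - X s = (X t - Z n t) + ((Z n t - Z n s) + (Z n s - X s)).
    by rewrite !subrKA.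
  rewrite (le_trans (ler_normD _ _)) // lerD // (le_trans (ler_normD _ _)) //.
  by rewrite lerD // distrC.
exists X; split=> // t t0; apply/eqP; rewrite -subr_eq0 -normr_le0.
apply/ler_addgt0Pl => e e0; rewrite addr0.
have Aw : 0 <= 2 * A * w t by rewrite mulr_ge0 ?expR_ge0 // mulr_ge0.
have [n ne] := geometric_le Aw e0.
rewrite -(subrKA (Z n.+1 t)) (le_trans (ler_normD _ _)) //.
have h1 := XZ n.+1 t t0.
have h2 : `|Z n.+1 t - picard f x0 X t| <= 2 * A * 2^-1 ^+ n / 2 * w t.
  apply: (@picard_contraction (Z n) X) => //.
    by rewrite mulr_ge0 ?exprn_ge0 // mulr_ge0.
  by move=> s s0; rewrite distrC; exact: XZ.
apply: le_trans (lerD h1 h2) _; apply: le_trans ne.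
by rewrite exprSr le_eqVlt; apply/orP; left; apply/eqP; field.
Unshelve. all: by end_near. Qed.
End picard_contraction.

(** * Solutions on [0, T[ *)

Lemma dnbhs_shift (R : realType) (V : topologicalType) (F : R -> V) (t : R) :
  F @ t^' = (fun h => F (h + t)) @ 0^'.
Proof.
apply/funext => A; rewrite propeqE /fmap /= /dnbhs /within /=.
apply: (iff_trans (nbhs0P (fun s => s != t -> A (F s)) t)).
split; apply: (@filterS _ _ (nbhs_filter (0 : R))) => h /= P.
  by move=> h0; rewrite addrC; apply: P; rewrite -subr_eq0 addrC addKr.
by move=> th; rewrite addrC; apply: P; rewrite -(inj_eq (addrI t)) addr0.
Qed.

(** The substitution [s = h + t] turns these quotients into those that define
derivatives, and limits of row vectors are limits of the coordinates. *)
Lemma diff_quot_cvgP (R : realType) (N : nat) (x : R -> 'rV[R]_N) (t : R) (d : 'rV[R]_N) :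
  diff_quot x t @ t^' --> d <->
  forall i, is_derive t 1 (fun s => x s 0 i) (d 0 i).
Proof.
have -> : diff_quot x t @ t^' = (fun h => h^-1 *: (x (h *: 1 + t) - x t)) @ 0^'.
  rewrite dnbhs_shift.
  have -> // : (fun h => diff_quot x t (h + t)) = (fun h => h^-1 *: (x (h *: 1 + t) - x t)).
  by apply/funext => h; rewrite /diff_quot addrK [h *: 1]mulr1.
split=> [xd i|xd].
- have dx : derivable x t 1 by apply/cvg_ex; exists d.
  have <- : 'D_1 x t = d by apply/cvg_lim => //; exact: norm_hausdorff.
  by rewrite derive_mx // mxE; apply/derivableP; move/derivable_mxP: dx; exact.
- have dx : derivable x t 1.
    by apply/derivable_mxP => i j; rewrite (ord1 i); case: (xd j).
  suff <- : 'D_1 x t = d by exact: dx.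
  by rewrite derive_mx //; apply/rowP => i; rewrite mxE; case: (xd i).
Qed.

Lemma within_dnbhs_proper (R : realType) (T t : R) :
  0 <= t -> t < T -> ProperFilter (within `[0, T[ t^').
Proof.
move=> t0 tT; apply: Build_ProperFilter => /= H.
have : \forall s \near t^'+, False.
  near=> s.
  have st : t < s by near: s; exact: nbhs_right_gt.
  have sT : s < T by near: s; exact: nbhs_right_lt.
  suff : (s != t) -> `[0, T[%classic s -> False.
    by apply; [rewrite gt_eqF|rewrite /= in_itv/= sT (le_trans t0 (ltW st))].
  near: s; apply: (@filterS _ (nbhs t) (nbhs_filter t) _ _ _ H) => s + _; exact.
by move=> /filter_ex[].
Unshelve. all: by end_near. Qed.

(** Clamping the argument extends a function that is continuous on a segment to a
continuous function on the line, to which [primitive] applies. *)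
Lemma continuous_clamp (R : realType) (V : topologicalType) (D : set R)
    (g : R -> V) (a b : R) :
  a <= b -> `[a, b] `<=` D -> {within D, continuous g} ->
  continuous (fun t => g (Num.min (Num.max t a) b)).
Proof.
move=> ab abD cg t.
pose c (s : R) : R := Num.min (Num.max s a) b.
have cD s : D (c s).
  by apply: abD; rewrite /= in_itv/= /c le_min ge_min le_max !lexx ab !orbT.
have cc : continuous c.
  move=> s; apply: (@continuous_min _ _ (fun s => Num.max s a) (cst b)) => //.
    by apply: (@continuous_max _ _ id (cst a)) => //; exact: cvg_cst.
  exact: cvg_cst.
move/subspace_continuousP : cg => /(_ _ (cD t)) cg.
apply: (@cvg_comp _ _ _ c g _ _ _ _ cg).
move=> A /(cc t) H; apply: (@filterS _ (nbhs t) (nbhs_filter t) _ _ _ H) => s.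
by apply; exact: cD.
Qed.

Lemma clampE (R : realType) (a b t : R) : a <= t -> t <= b -> Num.min (Num.max t a) b = t.
Proof. by move=> ? ?; rewrite max_l // min_l. Qed.

Section solutions.
Context (R : realType) (N : nat) (f : 'rV[R]_N -> 'rV[R]_N) (L : R).
Hypothesis L0 : 0 < L.
Hypothesis fL : forall p q, `|f p - f q| <= L * `|p - q|.
Variables (x0 : 'rV[R]_N) (T : R).

(** At an interior point the filter [within `[0, T[ t^'] is the full punctured
neighborhood filter, so one-sidedness plays a role at 0 only. *)
Lemma C1_solution_derive (y : R -> 'rV[R]_N) : C1_solution f x0 T y ->
  forall t, t \in `]0, T[ -> forall i,
    is_derive t 1 (fun s => y s 0 i) (f (y t) 0 i).
Proof.
move=> [[dy _] yE _] t; rewrite in_itv/= => /andP[t0 tT]; apply/diff_quot_cvgP.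
have tD : t \in `[0, T[ by rewrite in_itv/= (ltW t0).
rewrite -(yE t tD).
suff {1}-> : t^' = within `[0, T[%classic t^' by apply: dy.
apply/funext => A; rewrite propeqE /dnbhs /within /=; split.
  by apply: filterS => s H st _; exact: H.
move=> H; have It : \forall s \near t, s \in `]0, T[.
  by apply: near_in_itvoo; rewrite in_itv/= t0.
near=> s => st.
have : s \in `]0, T[ by near: s.
rewrite in_itv/= => /andP[s0 sT].
have : s != t -> s \in `[0, T[ -> A s by near: s; exact: H.
by apply => //; rewrite in_itv/= (ltW s0).
Unshelve. all: by end_near. Qed.

Lemma C1_solution_continuous (y : R -> 'rV[R]_N) : C1_solution f x0 T y ->
  {within `[0, T[, continuous y}.
Proof.
move=> [[dy _] _ _]; apply/subspace_continuousP => t tD.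
have /cvgrPdist_lt/(_ 1 ltr01) := dy t tD.
set d := lim _ => H.
have H' : \forall s \near nbhs t, s \in `[0, T[ -> `|y s - y t| <= `|s - t| * (`|d| + 1).
  move: H; rewrite /within /dnbhs /= /within /=; apply: (@filterS _ (nbhs t)) => s /= H sD.
  have [->|st] := eqVneq s t; first by rewrite !subrr !normr0 mul0r.
  have -> : y s - y t = (s - t) *: diff_quot y t s.
    by rewrite /diff_quot scalerA divff ?scale1r // subr_eq0.
  rewrite normrZ ler_wpM2l //.
  have := H st sD; rewrite distrC => h.
  rewrite -[diff_quot _ _ _](subrK d) (le_trans (ler_normD _ _)) //.
  by rewrite addrC lerD2l ltW.
apply/cvgrPdist_le => e e0; rewrite /within /=.
have d1 : 0 < `|d| + 1 by rewrite ltr_wpDl.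
have H2 : \forall s \near nbhs t, `|t - s| <= e / (`|d| + 1).
  by have /cvgrPdist_le := @cvg_id _ (nbhs t); apply; rewrite divr_gt0.
apply: (@filterS2 _ _ (nbhs_filter t) _ _ _ _ H' H2) => s h1 h2 sD.
by rewrite distrC (le_trans (h1 sD)) // -ler_pdivlMr // distrC.
Qed.

(** The distance [n] of two solutions satisfies [n <= L * primitive n].  The solutions
are clamped at [b] strictly between [t] and [T] since nothing is known of them at
[T]. *)
Lemma C1_solution_unique (y z : R -> 'rV[R]_N) :
  C1_solution f x0 T y -> C1_solution f x0 T z ->
  forall t, t \in `[0, T[ -> y t = z t.
Proof.
move=> sy sz t; rewrite in_itv/= => /andP[t0 tT].
pose b := (t + T) / 2.
have [tb bT] : t < b /\ b < T by rewrite /b; lra.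
have b0 : 0 <= b := ltW (le_lt_trans t0 tb).
have bD : `[0, b]%classic `<=` `[0, T[%classic.
  by move=> s /=; rewrite !in_itv/= => /andP[-> /le_lt_trans]; exact.
pose n s : R := `|y (Num.min (Num.max s 0) b) - z (Num.min (Num.max s 0) b)|.
have cn : continuous n.
  move=> s; apply: cvg_norm; apply: cvgB.
    exact: (continuous_clamp b0 bD (C1_solution_continuous sy)).
  exact: (continuous_clamp b0 bD (C1_solution_continuous sz)).
have nE s : 0 <= s -> s <= b -> n s = `|y s - z s|.
  by move=> s0 sb; rewrite /n clampE.
suff : n t <= 0.
  by rewrite nE // ?(ltW tb) // normr_le0 subr_eq0 => /eqP.
rewrite -(mul0r (expR (L * t))).
apply: (gronwall cn L0 _ t0 tb) => s s0 sb; rewrite add0r nE // ?(ltW sb) //.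
have sT := lt_trans sb bT.
apply/mx_norm_leP.
  by rewrite mulr_ge0 ?(ltW L0) // primitive_ge0 // => r; rewrite /n.
move=> i; rewrite !mxE.
have sD : `[0, s]%classic `<=` `[0, T[%classic.
  by move=> r /=; rewrite !in_itv/= => /andP[-> /le_lt_trans]; exact.
have cy w : C1_solution f x0 T w -> {within `[0, s], continuous (fun r => w r 0 i)}.
  move=> /C1_solution_continuous /(continuous_subspaceW sD) cw r.
  apply: (@continuous_comp _ _ _ (w : subspace _ -> _) (fun M : 'rV[R]_N => M 0 i)).
    exact: cw.
  exact: coord_continuous.
have := @mean_value_le R ((fun r => y r 0 i) - (fun r => z r 0 i)) (fun r => L * primitive n r)
  (fun r => f (y r) 0 i - f (z r) 0 i) (fun r => L * n r) 0 s s0.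
have [_ _ y00] := sy; have [_ _ z00] := sz.
rewrite !fctE y00 z00 primitive0 mulr0 subrr !subr0; apply.
- by apply: within_continuousB; exact: cy.
- move=> r; apply: cvgMr; exact: primitive_within.
- move=> r; rewrite in_itv/= => /andP[r0 rs].
  by apply: is_deriveB; apply: C1_solution_derive => //; rewrite in_itv/= r0 (lt_trans rs).
- move=> r; rewrite in_itv/= => /andP[r0 rs].
  by apply: is_deriveZ; apply: is_derive_primitive => //; rewrite (lt_trans _ r0) // ltrN10.
- move=> r; rewrite in_itv/= => /andP[r0 rs].
  rewrite nE ?(ltW r0) // ?(ltW (lt_trans rs sb)) //.
  have := coord_le_norm (f (y r) - f (z r)) i; rewrite !mxE => /le_trans; apply.
  exact: fL.
Qed.

(** Nothing is known of the fixed point [X] at negative times.  The solution is the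
function [Y] that coincides with [X] on [0, +oo[ and that, being defined by a
primitive, is differentiable at 0 on both sides. *)
Lemma C1_solution_exists : exists y : R -> 'rV[R]_N, C1_solution f x0 T y.
Proof.
have [X [cX XE]] := picard_fixed_point L0 fL x0.
have cf := lipschitz_continuous L0 fL.
have cfX : continuous (f \o X).
  by move=> t; apply: continuous_comp; [exact: cX|exact: cf].
pose Y t : 'rV[R]_N := x0 + \row_i primitive (fun s => f (X s) 0 i) t.
have YX t : 0 <= t -> Y t = X t.
  by move=> t0; rewrite XE // /picard positive_part_id.
have dY t : 0 <= t -> diff_quot Y t @ within `[0, T[ t^' --> f (X t).
  move=> t0; apply: cvg_within_filter; apply/diff_quot_cvgP => i.
  have -> : (fun s => Y s 0 i) = cst (x0 0 i) + primitive (fun s => f (X s) 0 i).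
    by apply/funext => s; rewrite /Y !mxE.
  rewrite -[f (X t) 0 i]add0r; apply: is_deriveD.
  apply: (@is_derive_primitive _ (fun s => f (X s) 0 i)).
    exact: (continuous_coord cfX).
  by rewrite (lt_le_trans _ t0) // ltrN10.
have Y' t : t \in `[0, T[ -> derive_within `[0, T[ Y t = f (X t).
  rewrite in_itv/= => /andP[t0 tT].
  have := within_dnbhs_proper t0 tT.
  by move=> ?; apply: cvg_lim; [exact: norm_hausdorff|exact: dY].
exists Y; split.
- split=> [t|].
    by rewrite /= in_itv/= => /andP[t0 _]; apply/cvg_ex; exists (f (X t)); exact: dY.
  have : {within `[0, T[, continuous (f \o X)} by exact: continuous_subspaceT.
  apply: subspace_eq_continuous => t tD; apply/esym/Y'.
  by rewrite inE in tD.
- by move=> t tD; rewrite Y' // YX //; move: tD; rewrite in_itv/= => /andP[].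
- by apply/rowP => i; rewrite /Y !mxE primitive0 addr0.
Qed.
End solutions.

(** * A smooth function with compact support *)

Definition parabola (R : realType) : {poly R} := 'X * (1 - 'X).

Lemma parabolaE (R : realType) (t : R) : (parabola R).[t] = t * (1 - t).
Proof. by rewrite /parabola !hornerE. Qed.

(** Elements [P u^m exp (- u)] with [u = 1 / (t (1 - t))], extended by 0 outside
]0, 1[.  The polynomial and the exponent are parameters so that all successive
derivatives of [exp (- u)] have this form. *)
Definition exp_bump (R : realType) (P : {poly R}) (m : nat) (t : R) : R :=
  if 0 < t < 1 then
    P.[t] * ((parabola R).[t]^-1) ^+ m * expR (- (parabola R).[t]^-1)
  else 0.

Lemma parabola_gt0 (R : realType) (t : R) : 0 < t < 1 -> 0 < (parabola R).[t].
Proof. by move=> /andP[t0 t1]; rewrite parabolaE mulr_gt0 // subr_gt0. Qed.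

Lemma is_derive_quadratic (R : realType) (h : R -> R) (t C : R) :
  (forall s, `|h s - h t| <= C * (s - t) ^+ 2) -> is_derive t 1 h 0.
Proof.
move=> hC.
have C0 : 0 <= C.
  by have := hC (t + 1); rewrite (addrC t 1) addrK expr1n mulr1; exact: le_trans.
have H : (fun d => d^-1 *: (h (d *: 1 + t) - h t)) @ 0^' --> (0 : R).
  apply/cvgrPdist_le => /= e e0; near=> d.
  have d0 : d != 0 by near: d; exact: nbhs_dnbhs_neq.
  rewrite sub0r normrN normrM normfV.
  have := hC (d *: 1 + t); rewrite addrK [d *: 1]mulr1 => h1.
  rewrite ler_pdivrMl ?normr_gt0 // (le_trans h1) //.
  rewrite -[d ^+ 2]ger0_norm ?sqr_ge0 // normrX expr2 mulrCA ler_wpM2l //.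
  have /andP[_] : true && (`|d| <= e / (C + 1)).
    by rewrite /=; near: d; apply: dnbhs0_le; rewrite divr_gt0 // ltr_wpDl.
  rewrite ler_pdivlMr ?ltr_wpDl // => h2; apply: le_trans h2.
  by rewrite mulrDr mulr1 mulrC lerDl.
apply: DeriveDef; first by apply/cvg_ex; exists 0.
exact/cvg_lim.
Unshelve. all: by end_near. Qed.

Lemma powM_expRN_le (R : realType) (u : R) (m : nat) : 0 <= u ->
  u ^+ m.+1 * expR (- u) <= m.+1`!%:R.
Proof.
move=> u0; rewrite expRN ler_pdivrMr ?expR_gt0 //.
have := expR_ge1Dxn m u0; set F := (_ `!)%:R => h.
have F0 : 0 < F by rewrite ltr0n fact_gt0.
rewrite mulrC -ler_pdivrMr //; apply: le_trans h.
by rewrite lerDr.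
Qed.

Lemma horner_bounded (R : realType) (P : {poly R}) :
  exists2 M : R, 0 <= M & forall t, 0 < t < 1 -> `|P.[t]| <= M.
Proof.
exists (\sum_(i < size P) `|P`_i|); first by rewrite sumr_ge0.
move=> t /andP[t0 t1]; rewrite horner_coef (le_trans (ler_norm_sum _ _ _)) //.
apply: ler_sum => i _; rewrite normrM ler_piMr // normrX.
by rewrite exprn_ile1 // ger0_norm ?ltW.
Qed.

(** With [q = t (1 - t) = 1 / u], the bound [u^(m+2) exp (- u) <= (m+2)!] shows that
the function is at most a constant times [q^2].  Inside ]0, 1[, [q] is at most
the distance to any point outside, so the function vanishes to second order
there. *)
Lemma exp_bump_flat (R : realType) (P : {poly R}) (m : nat) (t : R) :
  ~~ (0 < t < 1) -> is_derive t 1 (exp_bump P m) 0.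
Proof.
move=> tN; have [M M0 PM] := horner_bounded P.
apply: (@is_derive_quadratic _ _ _ (M * m.+2`!%:R)) => s.
rewrite {2}/exp_bump (negbTE tN) subr0 /exp_bump.
case: ifPn => s01; last by rewrite normr0 mulr_ge0 ?sqr_ge0 // mulr_ge0.
set q := (parabola R).[s]; have q0 : 0 < q := parabola_gt0 s01.
have -> : P.[s] * q^-1 ^+ m * expR (- q^-1) =
    P.[s] * (q^-1 ^+ m.+2 * expR (- q^-1)) * q ^+ 2.
  have qn0 : q != 0 by rewrite gt_eqF.
  have -> : q^-1 ^+ m.+2 = q^-1 * (q^-1 * q^-1 ^+ m) by rewrite !exprS.
  by set e := expR _; set r := _ ^+ m; field.
rewrite 2!normrM [X in _ * X]normrX; apply: ler_pM; rewrite ?exprn_ge0 ?mulr_ge0 //.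
- rewrite ler_pM ?PM // ger0_norm; last first.
    by rewrite mulr_ge0 ?expR_ge0 // exprn_ge0 // invr_ge0 ltW.
  by apply: powM_expRN_le; rewrite invr_ge0 ltW.
- rewrite -[leRHS]ger0_norm ?sqr_ge0 // normrX lerXn2r ?nnegrE //.
  rewrite gtr0_norm // /q parabolaE.
  case/andP : s01 => s0 s1; move: tN; rewrite negb_and -!leNgt => /orP[t0|t1].
    rewrite ger0_norm; last by lra.
    by nra.
  rewrite ler0_norm; last by lra.
  by nra.
Qed.

(** Inside ]0, 1[, the derivative is computed with [u' = - q' u^2]; the factors [q]
in the polynomial bring all three terms to the common power [u^(m+2)]. *)
Lemma exp_bump_derive (R : realType) (P : {poly R}) (m : nat) :
  exists Q n, forall t : R, is_derive t 1 (exp_bump P m) (exp_bump Q n t).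
Proof.
pose q := parabola R.
exists (P^`() * q ^+ 2 - (P * q * q^`()) *+ m + P * q^`()), m.+2 => t.
rewrite {2}/exp_bump; case: ifPn => [t01|tN]; last exact: exp_bump_flat.
have qt0 : q.[t] != 0 by rewrite gt_eqF // parabola_gt0.
pose u (s : R) : R := q.[s]^-1.
have du : is_derive t 1 u (- q^`().[t] * u t ^+ 2).
  apply: is_derive_eq; first exact: is_deriveV.
  by rewrite /GRing.scale/= /u; field.
have dum : is_derive t 1 (fun s => u s ^+ m) (m%:R * u t ^+ m * (- q^`().[t] * u t)).
  have -> : (fun s => u s ^+ m) = u ^+ m by apply/funext => s; rewrite exprfctE.
  apply: is_derive_eq; rewrite /GRing.scale/=.
  case: (m) => [|n] /=; first by rewrite !mul0r.
  by rewrite [u t ^+ n.+1]exprSr; ring.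
have de : is_derive t 1 (fun s => expR (- u s)) (q^`().[t] * u t ^+ 2 * expR (- u t)).
  by apply: is_derive_eq; rewrite /GRing.scale/=; ring.
apply: (@near_eq_is_derive _ _ _ (fun s => P.[s] * u s ^+ m * expR (- u s))).
  near=> s; rewrite /exp_bump.
  have : s \in `]0, 1[ by near: s; apply: near_in_itvoo; rewrite in_itv.
  by rewrite in_itv/= => ->.
have QE (r : {poly R}) :
    (P^`() * r ^+ 2 - (P * r * r^`()) *+ m + P * r^`()).[t] =
    P^`().[t] * r.[t] ^+ 2 - P.[t] * r.[t] * r^`().[t] *+ m + P.[t] * r^`().[t].
  by rewrite expr2 !(hornerD, hornerN, hornerMn, hornerM).
apply: is_derive_eq; rewrite QE -/q -/(u t) /GRing.scale/=.
have -> : u t ^+ m.+2 = u t ^+ 2 * u t ^+ m by rewrite -exprD.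
rewrite -[_ *+ m]mulr_natl /u; set U := _ ^+ m; set e := expR _.
by field.
Unshelve. all: by end_near. Qed.

(** Iterated derivatives of [h] are never computed: it is enough that [h] lies in a
set of differentiable functions that contains their derivatives. *)
Lemma derive1_stable_smooth (R : realType) (A : set (R -> R)) :
  (forall h, A h -> exists2 h', A h' & forall t : R, is_derive t 1 h (h' t)) ->
  forall h, A h -> forall n (t : R), derivable (derive1n n h) t 1.
Proof.
move=> Ad h Ah n t; suff /Ad[h' _ /(_ t) []//] : A (derive1n n h).
elim: n => [//|n /Ad[h' Ah' dh]]; rewrite derive1nS.
suff -> : derive1 (derive1n n h) = h' by [].
by apply/funext => s; rewrite derive1E; case: (dh s).
Qed.

Lemma scale_exp_bump (R : realType) (P : {poly R}) (m : nat) (k t : R) :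
  k * exp_bump P m t = exp_bump (k *: P) m t.
Proof. by rewrite /exp_bump; case: ifP => _; rewrite ?mulr0 // hornerZ !mulrA. Qed.

Lemma exp_bump_continuous (R : realType) (P : {poly R}) (m : nat) : continuous (exp_bump P m).
Proof.
have [Q [n dP]] := exp_bump_derive P m.
by move=> t; apply/differentiable_continuous/derivable1_diffP; case: (dP t).
Qed.

(** * Smooth steps and plateaus *)

Definition bump0 (R : realType) : R -> R := exp_bump 1 0.

Lemma bump0_ge0 (R : realType) (t : R) : 0 <= bump0 t.
Proof.
by rewrite /bump0 /exp_bump; case: ifP => // _; rewrite hornerC expr0 !mul1r expR_ge0.
Qed.

Lemma bump0_gt0 (R : realType) (t : R) : 0 < t < 1 -> 0 < bump0 t.
Proof. by rewrite /bump0 /exp_bump => ->; rewrite hornerC expr0 !mul1r expR_gt0. Qed.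

Lemma bump0_out (R : realType) (t : R) : ~~ (0 < t < 1) -> bump0 t = 0.
Proof. by rewrite /bump0 /exp_bump => /negbTE ->. Qed.

Lemma bump0_integrable (R : realType) :
  lebesgue_measure.-integrable [set: R] (EFin \o @bump0 R).
Proof.
have -> : @bump0 R = (@bump0 R) \_ `[0, 1].
  apply/funext => t; rewrite patchE; case: ifPn => // /negP tN; rewrite bump0_out //.
  apply/negP => /andP[t0 t1]; apply: tN; rewrite inE/= in_itv/=.
  by rewrite (ltW t0) (ltW t1).
rewrite -restrict_EFin; apply/integrable_restrict => //=; rewrite setTI.
exact/continuous_integrable/exp_bump_continuous.
Qed.

Definition bump_primitive (R : realType) (t : R) : R :=
  \int[lebesgue_measure]_(s in `]-oo, t]) bump0 s.

Lemma is_derive_bump_primitive (R : realType) (t : R) :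
  is_derive t 1 (@bump_primitive R) (bump0 t).
Proof.
have tt1 : t < t + 1 by rewrite ltrDl.
have it : lebesgue_measure.-integrable `]-oo, (t + 1)%R] (EFin \o @bump0 R).
  exact: integrableS (@bump0_integrable R).
have [dF <-] := @continuous_FTC1 R _ -oo%O t _ tt1 it (ltNyr _)
  (@exp_bump_continuous R 1 0 t).
by rewrite derive1E; exact/derivableP.
Qed.

Lemma bump_primitive_le0 (R : realType) (t : R) : t <= 0 -> bump_primitive t = 0.
Proof.
move=> t0; rewrite /bump_primitive (@eq_Rintegral _ _ _ _ _ (cst 0)).
  by rewrite /Rintegral integral0.
move=> s; rewrite inE/= in_itv/= => st; rewrite bump0_out //.
by rewrite negb_and -leNgt (le_trans st).
Qed.

Lemma bump_primitive_within (R : realType) (A : set R) :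
  {within A, continuous (@bump_primitive R)}.
Proof.
apply: continuous_subspaceT => t; apply/differentiable_continuous/derivable1_diffP.
by case: (is_derive_bump_primitive t).
Qed.

Lemma bump_primitive_ge1 (R : realType) (t : R) :
  1 <= t -> bump_primitive t = bump_primitive 1.
Proof.
move=> t1; apply/eqP; rewrite -subr_eq0 -normr_le0 -[leRHS](subrr (0 : R)).
apply: (@mean_value_le R (@bump_primitive R) (cst 0) (@bump0 R) (fun=> 0) 1 t t1).
- exact: bump_primitive_within.
- by apply: continuous_subspaceT => s; exact: cvg_cst.
- by move=> s _; exact: is_derive_bump_primitive.
- move=> s; rewrite in_itv/= => /andP[s1 _]; rewrite bump0_out ?normr0 //.
  by rewrite negb_and -!leNgt (ltW s1) orbT.
Qed.

Lemma bump_primitive_nd (R : realType) : {homo @bump_primitive R : s t / s <= t}.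
Proof.
move=> s t st; rewrite -subr_ge0 -(@normr0 _ R) -[in leLHS](subrr (0 : R)).
apply: (@mean_value_le R (cst 0) (@bump_primitive R) (fun=> 0) (@bump0 R) s t st).
- by apply: continuous_subspaceT => r; exact: cvg_cst.
- exact: bump_primitive_within.
- by move=> r _; exact: is_derive_bump_primitive.
- by move=> r _; rewrite normr0 bump0_ge0.
Qed.

Lemma bump_primitive1_gt0 (R : realType) : 0 < @bump_primitive R 1.
Proof.
have [||c c01] := @MVT R (@bump_primitive R) (@bump0 R) 0 1 ltr01.
- by move=> t _; exact: is_derive_bump_primitive.
- exact: bump_primitive_within.
by rewrite (bump_primitive_le0 (lexx 0)) !subr0 mulr1 => ->; exact: bump0_gt0.
Qed.

(** A smooth function that is 0 on the negative half-line and 1 on [1, +oo[. *)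
Definition step (R : realType) (t : R) : R := (bump_primitive 1)^-1 * bump_primitive t.

Definition dstep (R : realType) (t : R) : R := (bump_primitive 1)^-1 * bump0 t.

Lemma is_derive_step (R : realType) (t : R) : is_derive t 1 (@step R) (dstep t).
Proof. apply: is_deriveZ; exact: is_derive_bump_primitive. Qed.

Lemma dstep_ge0 (R : realType) (t : R) : 0 <= dstep t.
Proof. by rewrite mulr_ge0 ?bump0_ge0 // invr_ge0 ltW // bump_primitive1_gt0. Qed.

Lemma dstep_out (R : realType) (t : R) : ~~ (0 < t < 1) -> dstep t = 0.
Proof. by move=> tN; rewrite /dstep (bump0_out tN) mulr0. Qed.

Lemma dstep_continuous (R : realType) : continuous (@dstep R).
Proof. by move=> t; apply: cvgMr; exact: exp_bump_continuous. Qed.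

Lemma step_le0 (R : realType) (t : R) : t <= 0 -> step t = 0.
Proof. by move=> t0; rewrite /step (bump_primitive_le0 t0) mulr0. Qed.

Lemma step_ge1 (R : realType) (t : R) : 1 <= t -> step t = 1.
Proof.
by move=> t1; rewrite /step bump_primitive_ge1 // mulVf // gt_eqF // bump_primitive1_gt0.
Qed.

Lemma step_nd (R : realType) : {homo @step R : s t / s <= t}.
Proof.
move=> s t st; rewrite ler_wpM2l ?bump_primitive_nd // invr_ge0 ltW //.
exact: bump_primitive1_gt0.
Qed.

(** A smooth approximation of the indicator function of ]a, b]: both transitions, to
the right of [a] and of [b], have width [1 / k]. *)
Definition plateau (R : realType) (a b k : R) (t : R) : R :=
  step (k * (t - a)) - step (k * (t - b)).

Definition dplateau (R : realType) (a b k : R) (t : R) : R :=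
  k * dstep (k * (t - a)) - k * dstep (k * (t - b)).

Lemma is_derive_affine (R : realType) (k a t : R) :
  is_derive t 1 (fun s => k * (s - a)) k.
Proof. by apply: is_derive_eq; rewrite /GRing.scale/=; ring. Qed.

Lemma is_derive_comp_affine (R : realType) (h h' : R -> R) (k a t : R) :
  (forall s : R, is_derive s 1 h (h' s)) ->
  is_derive t 1 (fun s => h (k * (s - a))) (k * h' (k * (t - a))).
Proof.
move=> dh; rewrite [k * h' _]mulrC.
apply: (@is_derive1_comp _ h (fun s => k * (s - a))).
exact: is_derive_affine.
Qed.

Lemma is_derive_plateau (R : realType) (a b k t : R) :
  is_derive t 1 (plateau a b k) (dplateau a b k t).
Proof.
by apply: is_deriveB; apply: is_derive_comp_affine => s; exact: is_derive_step.
Qed.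

(** The derivatives of a plateau are differences of two rescaled functions from
the family [exp_bump]; the scaling factors are absorbed in the polynomials. *)
Lemma plateau_smooth (R : realType) (a b k : R) n (t : R) :
  derivable (derive1n n (plateau a b k)) t 1.
Proof.
pose B (h : R -> R) := exists P m Q n, h =
  fun t => exp_bump P m (k * (t - a)) - exp_bump Q n (k * (t - b)).
pose A (h : R -> R) := h = plateau a b k \/ B h.
move: n t; apply: (@derive1_stable_smooth _ A); last by left.
move=> h [->|[P [m [Q [p ->]]]]].
- exists (dplateau a b k); last exact: is_derive_plateau.
  pose P : {poly R} := k *: ((bump_primitive 1)^-1 *: 1).
  right; exists P, 0%N, P, 0%N.
  by apply/funext => t; rewrite -!scale_exp_bump.
- have [P' [m' dP]] := exp_bump_derive P m; have [Q' [p' dQ]] := exp_bump_derive Q p.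
  exists (fun t => k * exp_bump P' m' (k * (t - a)) - k * exp_bump Q' p' (k * (t - b))).
    by right; exists (k *: P'), m', (k *: Q'), p'; apply/funext => t; rewrite -!scale_exp_bump.
  by move=> t; apply: is_deriveB; apply: is_derive_comp_affine.
Qed.

Lemma plateau_test_function (R : realType) (T a b k : R) :
  0 < k -> 0 < a -> a <= b -> b + k^-1 < T -> test_function T (plateau a b k).
Proof.
move=> k0 a0 ab bT.
have supp : closure [set t | plateau a b k t != 0] `<=` `[a, b + k^-1].
  rewrite [X in _ `<=` X](closure_id _).1; last exact: itv_closed.
  apply: closure_subset => t /= t0; rewrite in_itv/=; apply/andP; split.
    rewrite leNgt; apply: contra t0 => ta; rewrite /plateau !step_le0 ?subrr //.
      by rewrite pmulr_rle0 // subr_le0 (le_trans (ltW ta)).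
    by rewrite pmulr_rle0 // subr_le0 ltW.
  rewrite leNgt; apply: contra t0 => ta; rewrite /plateau !step_ge1 ?subrr //.
    by rewrite -ler_pdivrMl // mulr1 lerBrDl ltW.
  by rewrite -ler_pdivrMl // mulr1 lerBrDl (le_trans _ (ltW ta)) // lerD2r.
split.
- exact: plateau_smooth.
- apply: subclosed_compact supp; [exact: closed_closure|exact: segment_compact].
- move=> t /supp /=; rewrite !in_itv/= => /andP[ta tb].
  by rewrite (lt_le_trans a0 ta) (le_lt_trans tb bT).
Qed.

(** * Recovering increments from a weak derivative *)

Lemma derive1_plateau (R : realType) (a b k : R) :
  derive1 (plateau a b k) = dplateau a b k.
Proof. by apply/funext => t; rewrite derive1E; case: (is_derive_plateau a b k t). Qed.

Lemma dplateau_continuous (R : realType) (a b k : R) : continuous (dplateau a b k).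
Proof.
have c d : continuous (fun t => k * dstep (k * (t - d))).
  move=> t; apply: cvgMr.
  apply: (@continuous_comp _ _ _ (fun t => k * (t - d)) (@dstep R)).
    apply/differentiable_continuous/derivable1_diffP.
    by case: (is_derive_affine k d t).
  exact: dstep_continuous.
by move=> t; apply: cvgB; exact: c.
Qed.

Lemma step01 (R : realType) (t : R) : 0 <= step t <= 1.
Proof.
apply/andP; split.
  have [t0|/ltW t0] := leP t 0; first by rewrite step_le0.
  by rewrite -(step_le0 (lexx 0)) step_nd.
have [t1|/ltW t1] := leP 1 t; first by rewrite step_ge1.
by rewrite -(step_ge1 (lexx 1)) step_nd.
Qed.

Lemma plateau_norm_le1 (R : realType) (a b k t : R) : `|plateau a b k t| <= 1.
Proof.
rewrite /plateau; move: (step01 (k * (t - a))) (step01 (k * (t - b))).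
by move=> /andP[? ?] /andP[? ?]; rewrite ler_norml; apply/andP; split; lra.
Qed.

Lemma step_near1 (R : realType) (c t : R) : c < t ->
  \forall n \near \oo, step (n.+1%:R * (t - c)) = 1.
Proof.
move=> ct; have tc : 0 < t - c by rewrite subr_gt0.
near=> n; apply: step_ge1.
rewrite -ler_pdivrMr // div1r.
apply: (@le_trans _ _ n%:R); last by rewrite ler_nat.
by near: n; exact: nbhs_infty_ger.
Unshelve. all: by end_near. Qed.

(** The sequence is eventually constant at every point. *)
Lemma plateau_cvg (R : realType) (v : R -> R) (a b t : R) : a <= b ->
  (v t * plateau a b n.+1%:R t) @[n --> \oo] --> (v \_ `]a, b]) t.
Proof.
move=> ab; apply: cvg_near_cst; rewrite patchE /plateau.
have step0 c (n : nat) : t <= c -> step (n.+1%:R * (t - c)) = 0.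
  by move=> tc; rewrite step_le0 // pmulr_rle0 // subr_le0.
case: ifPn => [|tab].
  rewrite inE/= in_itv/= => /andP[at_ tb]; near=> n.
  rewrite (step0 _ _ tb) subr0.
  have -> : step (n.+1%:R * (t - a)) = 1 by near: n; exact: step_near1.
  by rewrite mulr1.
have [ta|at_] := leP t a.
  by apply: nearW => n; rewrite !step0 // ?subrr ?mulr0 // (le_trans ta).
have bt : b < t.
  by move: tab; rewrite notin_setE/= in_itv/= at_/= => /negP; rewrite -ltNge.
near=> n.
have -> : step (n.+1%:R * (t - a)) = 1 by near: n; exact: step_near1.
have -> : step (n.+1%:R * (t - b)) = 1 by near: n; exact: step_near1.
by rewrite subrr mulr0.
Unshelve. all: by end_near. Qed.

Lemma integral_plateau_cvg (R : realType) (T : R) (v : R -> R) (a b : R) :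
  0 < a -> a <= b -> b < T ->
  lebesgue_measure.-integrable `]0, T[ (EFin \o v) ->
  \int[lebesgue_measure]_(t in `]0, T[) (v t * plateau a b n.+1%:R t) @[n --> \oo]
  --> \int[lebesgue_measure]_(t in `]a, b]) v t.
Proof.
move=> a0 ab bT iv.
have sub : `]a, b]%classic `<=` `]0, T[%classic.
  move=> t /=; rewrite !in_itv/= => /andP[at_ tb].
  by rewrite (lt_trans a0 at_) (le_lt_trans tb bT).
have -> : \int[lebesgue_measure]_(t in `]a, b]) v t =
    \int[lebesgue_measure]_(t in `]0, T[) (v \_ `]a, b]) t.
  by rewrite -Rintegral_mkcondr setIidr.
have iab : lebesgue_measure.-integrable `]0, T[ (EFin \o (v \_ `]a, b])).
  rewrite -restrict_EFin; apply/integrable_restrict => //=.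
  by rewrite setIidr //; apply: integrableS iv.
rewrite /Rintegral; apply: fine_cvg; rewrite fineK; last exact: integrable_fin_num.
have mv : measurable_fun `]0, T[ v by apply/measurable_EFinP; case/integrableP : iv.
apply: (@dominated_cvg _ _ _ lebesgue_measure `]0, T[%classic
  (measurable_itv _) (fun n t => (v t * plateau a b n.+1%:R t)%:E) (EFin \o (v \_ `]a, b]))
  (fun t => `|v t|%:E)) => //.
- move=> n; apply/measurable_EFinP/measurable_funM => //.
  apply: measurable_funTS; apply: continuous_measurable_fun => t.
  apply/differentiable_continuous/derivable1_diffP.
  by case: (is_derive_plateau a b n.+1%:R t).
- move=> t _; apply: cvg_EFin; first exact: nearW.
  exact: plateau_cvg.
- exact: (integrable_norm iv).
- by move=> n t _; rewrite /= lee_fin normrM ler_piMr // plateau_norm_le1.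
Qed.

(** The derivative of a plateau is the difference of two approximate unit masses at
[a] and at [b].  With [K c] the step at [c], the function
[primitive (u * plateau') - u a * K a + u b * K b] has derivative
[(u - u a) (K a)' - (u - u b) (K b)'].  By continuity of [u] this is bounded by
[e / 2 ((K a)' + (K b)')] for narrow steps, and [mean_value_le] on [0, T] concludes
since each [K c] grows from 0 to 1. *)
Lemma integral_dplateau_cvg (R : realType) (T : R) (u : R -> R) (a b : R) :
  continuous u -> 0 < a -> a <= b -> b < T ->
  \int[lebesgue_measure]_(t in `]0, T[) (u t * dplateau a b n.+1%:R t) @[n --> \oo]
  --> u a - u b.
Proof.
move=> cu a0 ab bT; have b0 := lt_le_trans a0 ab; have aT := le_lt_trans ab bT.
have T0 := lt_trans b0 bT.
apply/cvgrPdist_le => /= e e0.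
have e2 : 0 < e / 2 by rewrite divr_gt0.
have near_c c : c < T -> \forall n \near \oo, step (n.+1%:R * (T - c)) = 1 /\
    forall t, `|(u t - u c) * dstep (n.+1%:R * (t - c))| <= e / 2 * dstep (n.+1%:R * (t - c)).
  move=> cT; have /cvgrPdist_le /(_ _ e2) /nbhs_ballP[d /= d0 dP] := cu c.
  near=> n; split; first by near: n; exact: step_near1.
  move=> t; rewrite normrM (ger0_norm (dstep_ge0 _)).
  have [/andP[h0 h1]|h] := boolP (0 < n.+1%:R * (t - c) < 1); last first.
    by rewrite dstep_out // !mulr0.
  rewrite ler_wpM2r ?dstep_ge0 // distrC; apply: dP.
  rewrite /ball /= distrC.
  move: h0; rewrite pmulr_rgt0 // => h0; rewrite gtr0_norm //.
  move: h1; rewrite mulrC -ltr_pdivlMr // => h1; apply: (lt_trans h1).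
  rewrite div1r invf_plt // ?posrE // (@le_lt_trans _ _ n%:R) ?ltr_nat //.
  by near: n; exact: nbhs_infty_ger.
near=> n.
have [] : step (n.+1%:R * (T - a)) = 1 /\ forall t,
    `|(u t - u a) * dstep (n.+1%:R * (t - a))| <= e / 2 * dstep (n.+1%:R * (t - a)).
  by near: n; exact: near_c.
have [] : step (n.+1%:R * (T - b)) = 1 /\ forall t,
    `|(u t - u b) * dstep (n.+1%:R * (t - b))| <= e / 2 * dstep (n.+1%:R * (t - b)).
  by near: n; exact: near_c.
set k := n.+1%:R => Kb Hb Ka Ha.
have k0 : 0 < k by rewrite ltr0n.
pose g (t : R) : R := u t * dplateau a b k t.
have cg : continuous g.
  by move=> t; apply: cvgM; [exact: cu|exact: dplateau_continuous].
have -> : \int[lebesgue_measure]_(t in `]0, T[) g t = primitive g T.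
  have := primitiveB cg (lexx 0) (ltW T0); rewrite primitive0 subr0 => ->.
  rewrite -(@Rintegral_itv_bndo_bndc _ (BRight 0)) //.
  by apply: integrableS (continuous_integrable 0 T cg) => //; exact: subset_itv_oo_cc.
pose K (c t : R) : R := step (k * (t - c)).
have dK (c t : R) : is_derive t 1 (K c) (k * dstep (k * (t - c))).
  by apply: is_derive_comp_affine => s; exact: is_derive_step.
have cK c : continuous (K c).
  by move=> t; apply/differentiable_continuous/derivable1_diffP; case: (dK c t).
have K0 c : 0 < c -> K c 0 = 0.
  by move=> c0; rewrite /K step_le0 // pmulr_rle0 // sub0r oppr_le0 ltW.
pose G := primitive g - (fun t => u a * K a t - u b * K b t).
pose H (t : R) := e / 2 * (K a t + K b t).
have GE : G T - G 0 = primitive g T - (u a - u b).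
  by rewrite /G !fctE primitive0 (K0 a) // (K0 b) // [K a T]Ka [K b T]Kb; ring.
have HE : H T - H 0 = e.
  by rewrite /H (K0 a) // (K0 b) // [K a T]Ka [K b T]Kb; field.
rewrite distrC -GE -[leRHS]HE.
apply: (@mean_value_le R G H
  (fun t => g t - (u a * (k * dstep (k * (t - a))) - u b * (k * dstep (k * (t - b)))))
  (fun t => e / 2 * (k * dstep (k * (t - a)) + k * dstep (k * (t - b))))
  0 T (ltW T0)).
- apply: within_continuousB; first exact: primitive_within.
  by apply: continuous_subspaceT => t; apply: cvgB; apply: cvgMr; exact: cK.
- by apply: continuous_subspaceT => t; apply: cvgMr; apply: cvgD; exact: cK.
- move=> t; rewrite in_itv/= => /andP[t0 _].
  apply: is_deriveB.
    by apply: is_derive_primitive => //; rewrite (lt_trans _ t0) // ltrN10.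
  by apply: is_deriveB; apply: is_deriveZ; exact: dK.
- by move=> t _; apply: is_deriveZ; apply: is_deriveD; exact: dK.
- move=> t _; rewrite /g /dplateau.
  have -> : u t * (k * dstep (k * (t - a)) - k * dstep (k * (t - b))) -
      (u a * (k * dstep (k * (t - a))) - u b * (k * dstep (k * (t - b)))) =
    k * ((u t - u a) * dstep (k * (t - a)) - (u t - u b) * dstep (k * (t - b))) by ring.
  rewrite normrM gtr0_norm // -mulrDr [leRHS]mulrCA ler_wpM2l ?(ltW k0) //.
  by rewrite (le_trans (ler_normB _ _)) // [leRHS]mulrDr lerD.
Unshelve. all: by end_near. Qed.

(** Both sides of the weak formulation are passed to the limit along plateaus that
tend to the indicator function of ]a, b]. *)
Lemma weak_derivative_increment (R : realType) (T : R) (u v : R -> R) (a b : R) :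
  continuous u -> lebesgue_measure.-integrable `]0, T[ (EFin \o v) ->
  (forall phi, test_function T phi ->
    \int[lebesgue_measure]_(t in `]0, T[) (u t * derive1 phi t) =
    - \int[lebesgue_measure]_(t in `]0, T[) (v t * phi t)) ->
  0 < a -> a <= b -> b < T ->
  u b - u a = \int[lebesgue_measure]_(t in `]a, b]) v t.
Proof.
move=> cu iv weak a0 ab bT.
have h1 := integral_dplateau_cvg cu a0 ab bT.
have /cvgN h2 := integral_plateau_cvg a0 ab bT iv.
rewrite -[LHS]opprB; apply/eqP; rewrite eqr_oppLR; apply/eqP.
apply: (cvg_unique _ h1); first exact: Rhausdorff.
apply: cvg_trans h2; apply: near_eq_cvg; near=> n.
have pt : test_function T (plateau a b n.+1%:R).
  apply: plateau_test_function => //; rewrite -ltrBrDl invf_plt ?posrE ?subr_gt0 //.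
  rewrite (@le_lt_trans _ _ n%:R) ?ltr_nat //.
  by near: n; exact: nbhs_infty_ger.
by have := weak _ pt; rewrite derive1_plateau => ->.
Unshelve. all: by end_near. Qed.

(** * Square-integrable functions *)

Lemma enorm2_ge0 (R : realType) (N : nat) (v : 'rV[R]_N) : 0 <= enorm2 v.
Proof. by apply: sumr_ge0 => i _; exact: sqr_ge0. Qed.

Lemma sqr_coord_le_enorm2 (R : realType) (N : nat) (v : 'rV[R]_N) i :
  v 0 i ^+ 2 <= enorm2 v.
Proof.
by rewrite /enorm2 (bigD1 i) //= lerDl; apply: sumr_ge0 => j _; exact: sqr_ge0.
Qed.

Lemma measurable_enorm2 (R : realType) (N : nat) (D : set R) (z : R -> 'rV[R]_N) :
  (forall i, measurable_fun D (fun t => z t 0 i)) ->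
  measurable_fun D (fun t => enorm2 (z t)).
Proof.
move=> mz; apply: measurable_sum => i.
exact: measurable_funX.
Qed.

Lemma integrable_cst_itv (R : realType) (T c : R) :
  lebesgue_measure.-integrable `]0, T[ (EFin \o cst c).
Proof.
have cc : continuous (cst c : R -> R) by move=> t; exact: cvg_cst.
by apply: integrableS (continuous_integrable 0 T cc) => //; exact: subset_itv_oo_cc.
Qed.

Lemma L2_enorm2_integrable (R : realType) (N : nat) (T : R) (z : R -> 'rV[R]_N) :
  L2 T z -> lebesgue_measure.-integrable `]0, T[ (EFin \o (fun t => enorm2 (z t))).
Proof.
move=> [mz zoo]; apply/integrableP; split.
  by apply/measurable_EFinP; exact: measurable_enorm2.
by under eq_integral do rewrite /= ger0_norm ?enorm2_ge0 //.
Qed.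

Lemma L2_integrable (R : realType) (N : nat) (T : R) (z : R -> 'rV[R]_N) i :
  L2 T z -> lebesgue_measure.-integrable `]0, T[ (EFin \o (fun t => z t 0 i)).
Proof.
move=> Lz; have [mz _] := Lz.
apply: (@le_integrable _ _ _ lebesgue_measure _ _ _ (fun t => (1 + enorm2 (z t))%:E)) => //.
- by apply/measurable_EFinP; exact: mz.
- move=> t _; rewrite /= lee_fin [leRHS]ger0_norm; last by rewrite addr_ge0 ?enorm2_ge0.
  have := sqr_coord_le_enorm2 (z t) i; set a := z t 0 i => h.
  have : `|a| ^+ 2 = a ^+ 2 by rewrite -normrX ger0_norm ?sqr_ge0.
  by move: (normr_ge0 a); nra.
- exact: (integrableD _ (integrable_cst_itv T 1) (L2_enorm2_integrable Lz)).
Qed.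

(** Cauchy-Schwarz against the constant 1.  With [c] the mean value of [|z_i|], it is
obtained by integrating [2 c |z_i| <= z_i^2 + c^2]. *)
Lemma L2_integral_norm_le (R : realType) (N : nat) (T : R) (z : R -> 'rV[R]_N) i :
  0 < T -> L2 T z ->
  (\int[lebesgue_measure]_(t in `]0%R, T[) `|z t 0 i|) ^+ 2 <=
  T * \int[lebesgue_measure]_(t in `]0%R, T[) enorm2 (z t).
Proof.
move=> T0 Lz.
set I := \int[_]_(t in _) `|_|; set J := \int[_]_(t in _) enorm2 _.
pose c := I / T.
have muT : fine (lebesgue_measure `]0, T[%classic) = T.
  by rewrite lebesgue_measure_itv/= lte_fin T0 oppr0 addr0.
have ii := integrable_norm (L2_integrable i Lz).
have ii2 : lebesgue_measure.-integrable `]0, T[ (EFin \o (fun t => 2 * c * `|z t 0 i|)).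
  exact: (integrableZl _ _ ii).
have ij := L2_enorm2_integrable Lz.
have ic := integrable_cst_itv T (c ^+ 2).
have : \int[lebesgue_measure]_(t in `]0, T[) (2 * c * `|z t 0 i|) <=
       \int[lebesgue_measure]_(t in `]0, T[) (enorm2 (z t) + c ^+ 2).
  apply: le_Rintegral => //; first exact: (integrableD _ ij ic).
  move=> t _; have := sqr_coord_le_enorm2 (z t) i; set a := z t 0 i => h.
  have : `|a| ^+ 2 = a ^+ 2 by rewrite -normrX ger0_norm ?sqr_ge0.
  by have := sqr_ge0 (`|a| - c); nra.
rewrite RintegralZl // RintegralD // (Rintegral_cst _ _ (c ^+ 2)) // -/I -/J muT.
rewrite /c => h.
have -> : I ^+ 2 = T * (2 * (I / T) * I - (I / T) ^+ 2 * T) by field; rewrite gt_eqF.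
by rewrite ler_pM2l // lerBlDr.
Qed.

(** * The estimate *)

Lemma H1_coord_increment (R : realType) (N : nat) (T : R) (x dx : R -> 'rV[R]_N) i (a b : R) :
  0 < T -> {within `[0, T], continuous x} -> H1_with_derivative T x dx ->
  0 < a -> a <= b -> b < T ->
  x b 0 i - x a 0 i = \int[lebesgue_measure]_(t in `]a, b]) dx t 0 i.
Proof.
move=> T0 cx [_ Ldx weak] a0 ab bT.
pose u (t : R) := x (Num.min (Num.max t 0) T) 0 i.
have cu : continuous u.
  apply: continuous_coord; exact: (continuous_clamp (ltW T0) (@subset_refl _ _) cx).
have uE t : 0 <= t -> t <= T -> u t = x t 0 i.
  by move=> t0 tT; rewrite /u clampE.
have := @weak_derivative_increment R T u (fun t => dx t 0 i) a b cu
  (L2_integrable i Ldx) _ a0 ab bT.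
rewrite !uE ?(ltW a0) ?(ltW bT) ?(le_trans (ltW a0)) ?(le_trans ab) ?(ltW bT) //; apply.
move=> phi phiT; rewrite -weak //; apply: eq_Rintegral => t.
by rewrite inE/= in_itv/= => /andP[/ltW t0 /ltW tT]; rewrite uE.
Qed.

Section estimate.
Context (R : realType) (N : nat) (f : 'rV[R]_N -> 'rV[R]_N) (L : R).
Hypothesis L0 : 0 < L.
Hypothesis fL : forall p q, `|f p - f q| <= L * `|p - q|.
Variables (x0 : 'rV[R]_N) (T : R).
Hypothesis T0 : 0 < T.
Variable xbar : R -> 'rV[R]_N.
Hypothesis sol : C1_solution f x0 T xbar.
Variables x dx : R -> 'rV[R]_N.
Hypothesis cx : {within `[0, T], continuous x}.
Hypothesis x00 : x 0 = 0.
Hypothesis H1x : H1_with_derivative T x dx.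

Let r (t : R) : 'rV[R]_N := dx t - f (x0 + x t).

(* [x] is controlled on [0, T] only, while [primitive] needs continuity on the line. *)
Let x_ext (t : R) := x (Num.min (Num.max t 0) T).

Let cx_ext : continuous x_ext.
Proof. exact: (continuous_clamp (ltW T0) (@subset_refl _ _) cx). Qed.

Let x_extE t : 0 <= t -> t <= T -> x_ext t = x t.
Proof. by move=> t0 tT; rewrite /x_ext clampE. Qed.

Let p (t : R) := f (x0 + x_ext t).

Let cp : continuous p.
Proof.
move=> t; apply: (@continuous_comp _ _ _ (fun t => x0 + x_ext t) f).
  by apply: cvgD; [exact: cvg_cst|exact: cx_ext].
exact: (lipschitz_continuous L0 fL).
Qed.

Let residual_increment i (a b : R) : L2 T r ->
  0 < a -> a <= b -> b < T ->
  x b 0 i - x a 0 i = \int[lebesgue_measure]_(t in `]a, b]) r t 0 i +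
    (primitive (fun t => p t 0 i) b - primitive (fun t => p t 0 i) a).
Proof.
move=> Lr a0 ab bT; rewrite (H1_coord_increment i T0 cx H1x a0 ab bT).
have cpi : continuous (fun t => p t 0 i) by exact: continuous_coord.
have sub : `]a, b]%classic `<=` `]0, T[%classic.
  move=> t /=; rewrite !in_itv/= => /andP[at_ tb].
  by rewrite (lt_trans a0 at_) (le_lt_trans tb bT).
rewrite (primitiveB cpi (ltW a0) ab) -RintegralD //.
- apply: eq_Rintegral => t; rewrite inE => /sub; rewrite /= in_itv/= => /andP[t0 tT].
  by rewrite /r /p x_extE ?(ltW t0) ?(ltW tT) // !mxE subrK.
- by apply: integrableS (L2_integrable i Lr).
- apply: integrableS (continuous_integrable 0 T cpi) => //.
  by apply: (subset_trans sub); exact: subset_itv_oo_cc.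
Qed.

(** Gronwall for [n = |x0 + x - xbar|].  Increments are only known between points of
]0, T[, so the inequality [n s <= B + L * primitive n s] is proved between a small
[a > 0] and [s], with [a] tending to 0, where the deviation vanishes. *)
Lemma deviation_le (t : R) : L2 T r -> 0 <= t -> t < T ->
  `|x0 + x t - xbar t| <=
    Num.sqrt (T * \int[lebesgue_measure]_(s in `]0, T[) enorm2 (r s)) * expR (L * t).
Proof.
move=> Lr t0 tT; set B := Num.sqrt _.
pose b := (t + T) / 2.
have [tb bT] : t < b /\ b < T by rewrite /b; lra.
have b0 : 0 <= b := ltW (le_lt_trans t0 tb).
have bD : `[0, b]%classic `<=` `[0, T[%classic.
  by move=> s /=; rewrite !in_itv/= => /andP[-> /le_lt_trans]; exact.
pose w (s : R) := x0 + x_ext s - xbar (Num.min (Num.max s 0) b).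
have cw : continuous w.
  move=> s; apply: cvgB; last exact: (continuous_clamp b0 bD (C1_solution_continuous sol)).
  by apply: cvgD; [exact: cvg_cst|exact: cx_ext].
have wE s : 0 <= s -> s <= b -> w s = x0 + x s - xbar s.
  by move=> s0 sb; rewrite /w x_extE ?clampE // (le_trans sb) // ltW.
pose n s := `|w s|.
have cn : continuous n by move=> s; apply: cvg_norm; exact: cw.
have B0 : 0 <= B := sqrtr_ge0 _.
have rB i : \int[lebesgue_measure]_(s in `]0, T[) `|r s 0 i| <= B.
  rewrite -[leLHS]ger0_norm; last by apply: Rintegral_ge0.
  rewrite -sqrtr_sqr ler_sqrt; first exact: L2_integral_norm_le.
  apply: mulr_ge0; first exact: ltW.
  by apply: Rintegral_ge0 => s _; exact: enorm2_ge0.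
have w00 : w 0 = 0.
  by rewrite wE // x00; case: sol => _ _ ->; rewrite addr0 subrr.
rewrite -wE // ?(ltW tb) // -/(n t).
apply: (gronwall cn L0 _ t0 tb) => s s0 sb.
have prim_ge0 c : 0 <= c -> 0 <= primitive n c by apply: primitive_ge0 => // s1; rewrite /n.
have LP0 : 0 <= L * primitive n s by rewrite mulr_ge0 ?prim_ge0 // ltW.
move: s0; rewrite le_eqVlt => /predU1P[<-|s0].
  by rewrite /n w00 normr0 primitive0 mulr0 addr0.
apply/mx_norm_leP; first by rewrite addr_ge0.
move=> i; apply/ler_addgt0Pl => e e0.
have [a /andP[a0 as_] wa] : exists2 a, 0 < a < s & `|w a 0 i| <= e.
  have /cvgrPdist_le/(_ e e0) : {for 0, continuous (fun t => w t 0 i)} by exact: continuous_coord.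
  move=> H; near (0:R)^'+ => a; exists a.
    by apply/andP; split; near: a; [exact: nbhs_right_gt|exact: nbhs_right_lt].
  have : `|w 0 0 i - w a 0 i| <= e.
    by near: a; apply: (@filterS _ (nbhs (0:R)) (nbhs_filter 0) _ _ _ H).
  by rewrite w00 mxE sub0r normrN.
have sT := lt_trans sb bT.
have cpi : continuous (fun t => p t 0 i) by exact: continuous_coord.
pose G (c : R) := primitive (fun t => p t 0 i) c - xbar c 0 i.
have wi : w s 0 i = w a 0 i + \int[lebesgue_measure]_(t in `]a, s]) r t 0 i + (G s - G a).
  have := residual_increment i Lr a0 (ltW as_) sT.
  rewrite !wE ?(ltW a0) ?(ltW s0) ?(ltW sb) ?(ltW (lt_trans as_ sb)) // !mxE /G.
  by lra.
have Ir : `|\int[lebesgue_measure]_(t in `]a, s]) r t 0 i| <= B.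
  apply: le_trans (rB i).
  have sub : `]a, s]%classic `<=` `]0, T[%classic.
    move=> c /=; rewrite !in_itv/= => /andP[ac cs].
    by rewrite (lt_trans a0 ac) (le_lt_trans cs sT).
  have ir := L2_integrable i Lr.
  rewrite (le_trans (le_normr_Rintegral _ _)) //; first by apply: integrableS ir.
  rewrite /Rintegral fine_le //.
  - by apply: integrable_fin_num => //; apply: integrable_norm; apply: integrableS ir.
  - by apply: integrable_fin_num => //; exact: integrable_norm.
  - apply: ge0_subset_integral => //.
    apply/measurable_EFinP; apply: measurableT_comp => //.
    by apply/measurable_EFinP; case/integrableP : ir.
have IG : `|G s - G a| <= L * primitive n s - L * primitive n a.
  apply: (@mean_value_le R G (fun c => L * primitive n c)
    (fun c => p c 0 i - f (xbar c) 0 i) (fun c => L * n c) a s (ltW as_)).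
  - apply: within_continuousB; first by apply: primitive_within => //; exact: ltW.
    apply: derivable_within_continuous => c; rewrite in_itv/= => /andP[ac cs].
    have cT : c \in `]0, T[ by rewrite in_itv/= (lt_le_trans a0 ac) (le_lt_trans cs sT).
    by case: (C1_solution_derive sol cT i).
  - by move=> c; apply: cvgMr; apply: primitive_within => //; exact: ltW.
  - move=> c; rewrite in_itv/= => /andP[ac cs]; have c0 := lt_trans a0 ac.
    apply: is_deriveB.
      by apply: is_derive_primitive => //; rewrite (lt_trans _ c0) // ltrN10.
    by apply: (C1_solution_derive sol); rewrite in_itv/= c0 (lt_trans cs sT).
  - move=> c; rewrite in_itv/= => /andP[ac cs]; have c0 := lt_trans a0 ac.
    by apply: is_deriveZ; apply: is_derive_primitive => //; rewrite (lt_trans _ c0) // ltrN10.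
  - move=> c; rewrite in_itv/= => /andP[ac cs]; have c0 := lt_trans a0 ac.
    have := coord_le_norm (p c - f (xbar c)) i; rewrite !mxE => /le_trans; apply.
    have cb := lt_trans cs sb.
    rewrite /n wE ?(ltW c0) ?(ltW cb) // /p x_extE ?(ltW c0) ?(ltW (lt_trans cb bT)) //.
have La0 : 0 <= L * primitive n a.
  by apply: mulr_ge0; [exact: ltW|apply: prim_ge0; exact: ltW].
have h1 := ler_normD (w a 0 i + \int[lebesgue_measure]_(t in `]a, s]) r t 0 i) (G s - G a).
have h2 := ler_normD (w a 0 i) (\int[lebesgue_measure]_(t in `]a, s]) r t 0 i).
rewrite wi (le_trans h1) // (le_trans (lerD (le_trans h2 (lerD wa Ir)) IG)) //.
by rewrite [leRHS]addrA lerD2l gerBl.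
Unshelve. all: by end_near. Qed.

Lemma sqr_sum_le (a b c : R) : `|b| <= c -> (a + b) ^+ 2 <= 2 * a ^+ 2 + 2 * c ^+ 2.
Proof.
move=> bc; have : b ^+ 2 <= c ^+ 2.
  by rewrite -[b ^+ 2]ger0_norm ?sqr_ge0 // normrX lerXn2r ?nnegrE // (le_trans _ bc).
by have := sqr_ge0 (a - b); nra.
Qed.

Lemma deviation_derivative_le :
  (\int[lebesgue_measure]_(s in `]0%R, T[)
      (enorm2 (dx s - derive_within `[0, T[ xbar s))%:E
   <= (2 + 2 * N%:R * (L ^+ 2 * expR (L * T) ^+ 2 * T) * T)%:E *
      \int[lebesgue_measure]_(s in `]0%R, T[)
        (enorm2 (dx s - f (x0 + x s)))%:E)%E.
Proof.
set C := (X in X%:E).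
have C0 : 0 < C.
  by rewrite ltr_wpDr // !mulr_ge0 // ?exprn_ge0 // ?expR_ge0 // ltW.
have mf (z : R -> 'rV[R]_N) i : {within `]0, T[, continuous z} ->
    measurable_fun `]0, T[ (fun t => f (z t) 0 i).
  move=> cz; apply: subspace_continuous_measurable_fun => //.
  move=> t; apply: (@continuous_comp _ _ _ (z : subspace _ -> _) (fun y => f y 0 i)).
    exact: cz.
  by apply: continuous_coord; exact: lipschitz_continuous fL.
have [_ Ldx _] := H1x; have [mdx _] := Ldx.
have subc : `]0, T[%classic `<=` `[0, T]%classic by exact: subset_itv_oo_cc.
have subco : `]0, T[%classic `<=` `[0, T[%classic by exact: subset_itv_oo_co.
have mr i : measurable_fun `]0, T[ (fun t => r t 0 i).
  have -> : (fun t => r t 0 i) = (fun t => dx t 0 i) \- (fun t => f (x0 + x t) 0 i).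
    by apply/funext => t; rewrite /r !mxE.
  apply: measurable_funB; first exact: mdx.
  apply: mf; apply: (continuous_subspaceW subc).
  by move=> t; apply: cvgD; [exact: cvg_cst|exact: cx].
have mxb i : measurable_fun `]0, T[ (fun t => (dx t - derive_within `[0, T[ xbar t) 0 i).
  apply: (@eq_measurable_fun _ _ _ _ _ ((fun t => dx t 0 i) \- (fun t => f (xbar t) 0 i))).
    move=> t; rewrite inE => /subco tT.
    by case: sol => _ /(_ t tT) E _; rewrite !mxE E.
  apply: measurable_funB; first exact: mdx.
  apply: mf; apply: (continuous_subspaceW subco).
  exact: (C1_solution_continuous sol).
have J0 : (0 <= \int[lebesgue_measure]_(s in `]0%R, T[) (enorm2 (r s))%:E)%E.
  by apply: integral_ge0 => s _; rewrite lee_fin enorm2_ge0.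
(* An infinite residual makes the right-hand side infinite. *)
have [Joo|Jfin] := eqVneq (\int[lebesgue_measure]_(s in `]0%R, T[) (enorm2 (r s))%:E)%E +oo%E.
  by rewrite -/r Joo gt0_muley ?leey // lte_fin.
have Lr : L2 T r by split=> //; rewrite ltey.
set j := \int[lebesgue_measure]_(s in `]0, T[) enorm2 (r s).
have jE : (\int[lebesgue_measure]_(s in `]0%R, T[) (enorm2 (r s))%:E)%E = j%:E.
  by rewrite /j /Rintegral fineK // ge0_fin_numE // ltey.
have j0 : 0 <= j by rewrite -lee_fin -jE.
rewrite -/r jE.
pose k := L ^+ 2 * expR (L * T) ^+ 2 * T * j.
have pointwise (s : R) : `]0, T[%classic s ->
    enorm2 (dx s - derive_within `[0, T[ xbar s) <= 2 * enorm2 (r s) + 2 * N%:R * k.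
  move=> sT; have := subco _ sT; case: sol => _ E _ /E ->.
  move: sT; rewrite /= in_itv/= => /andP[s0 sT].
  have dev := deviation_le Lr (ltW s0) sT.
  have fdev i : `|(f (x0 + x s) - f (xbar s)) 0 i| <=
      L * (Num.sqrt (T * j) * expR (L * T)).
    rewrite (le_trans (coord_le_norm _ _)) // (le_trans (fL _ _)) // ler_pM2l //.
    rewrite (le_trans dev) // ler_wpM2l ?sqrtr_ge0 // ler_expR ler_pM2l //. exact: ltW.
  have -> : 2 * enorm2 (r s) + 2 * N%:R * k =
      \sum_(i < N) (2 * r s 0 i ^+ 2 + 2 * (L * (Num.sqrt (T * j) * expR (L * T))) ^+ 2).
    rewrite big_split /= -mulr_sumr sumr_const card_ord -/(enorm2 _); congr (_ + _).
    rewrite !exprMn sqr_sqrtr ?mulr_ge0 ?(ltW T0) // -mulr_natl /k; ring.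
  apply: ler_sum => i _; have := sqr_sum_le (r s 0 i) (fdev i).
  by rewrite /r !mxE subrKA.
apply: (@le_trans _ _ (\int[lebesgue_measure]_(s in `]0%R, T[)
    (2 * enorm2 (r s) + 2 * N%:R * k)%:E)%E).
  apply: ge0_le_integral => //.
  - by move=> s _; rewrite lee_fin enorm2_ge0.
  - by apply/measurable_EFinP; exact: measurable_enorm2.
  - apply/measurable_EFinP/measurable_funD => //.
    by apply: measurable_funM => //; exact: measurable_enorm2.
have ij := L2_enorm2_integrable Lr.
have i2j : lebesgue_measure.-integrable `]0, T[ (EFin \o (fun s => 2 * enorm2 (r s))).
  exact: (integrableZl _ _ ij).
have ic := integrable_cst_itv T (2 * N%:R * k).
rewrite -[leLHS](fineK (integrable_fin_num _ (integrableD _ i2j ic))) //.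
rewrite [fine _](RintegralD _ i2j ic) //.
rewrite RintegralZl // (Rintegral_cst _ _ (2 * N%:R * k)) // -/j.
have -> : fine (lebesgue_measure `]0, T[%classic) = T.
  by rewrite lebesgue_measure_itv/= lte_fin T0 oppr0 addr0.
by rewrite -EFinM lee_fin /C /k le_eqVlt; apply/orP; left; apply/eqP; ring.
Qed.
End estimate.

Theorem theorem2p3 (R : realType) (N : nat) (f : 'rV[R]_N -> 'rV[R]_N)
    (f_C1 : C1_map f) (f_bnd : bounded_gradient f)
    (x0 : 'rV[R]_N) (T : R) (T_gt0 : 0 < T) :
  exists xbar : R -> 'rV[R]_N,
    [/\ C1_solution f x0 T xbar,
        forall y : R -> 'rV[R]_N, C1_solution f x0 T y ->
          forall t, t \in `[0, T[ -> y t = xbar t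
      & exists2 C : R, 0 < C &
          forall x : R -> 'rV[R]_N, HH T x ->
          forall dx : R -> 'rV[R]_N, H1_with_derivative T x dx ->
            (\int[lebesgue_measure]_(s in `]0%R, T[)
               (enorm2 (dx s - derive_within `[0, T[ xbar s))%:E
             <= C%:E * \int[lebesgue_measure]_(s in `]0%R, T[)
                         (enorm2 (dx s - f (x0 + x s)))%:E)%E].
Proof.
have [L L0 fL] := bounded_gradient_lipschitz f_C1 f_bnd.
have [xbar sol] := C1_solution_exists L0 fL x0 T.
exists xbar; split=> //.
  by move=> y soly t tT; exact: (C1_solution_unique L0 fL soly sol).
exists (2 + 2 * N%:R * (L ^+ 2 * expR (L * T) ^+ 2 * T) * T).
  by rewrite ltr_wpDr // !mulr_ge0 // ?exprn_ge0 // ?expR_ge0 // ltW.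
move=> x [_ cx x_0] dx H1x.
exact: (deviation_derivative_le L0 fL T_gt0 sol cx x_0 H1x).
Qed.
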